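(* Let $n\ge 3$ be an integer and let $\alpha\in(0,n)$, $\lambda>0$ and $\sigma>g_\alpha(\lambda)$ be real constants. Let $\varphi:(0,1)\to(0,\infty)$ be a continuous function satisfying $\lim_{t\to0^+}\varphi(t)=\infty$. Then there exists a nonnegative function $u\in C^2(\mathbb{R}^n\setminus\{0\})\cap L^\lambda(\mathbb{R}^n)$ satisfying $$0\le-\Delta u\le(|x|^{-\alpha}*u^\lambda)\,u^\sigma\quad\text{in }B_2(0)\setminus\{0\}$$ such that $$u(x)\ne O(\varphi(|x|))\quad\text{as }x\to0.$$
   Context: $B_r(x)$ is the open ball in $\mathbb{R}^n$ of radius $r$ centered at $x$. The convolution is over $\mathbb{R}^n$: $(|x|^{-\alpha}*u^\lambda)(x)=\int_{\mathbb{R}^n}\frac{u(y)^\lambda}{|x-y|^\alpha}\,dy$. For $\lambda>0$ (including $\lambda<1$), $u\in L^\lambda(\mathbb{R}^n)$ means $\int_{\mathbb{R}^n}|u|^\lambda<\infty$. The differential inequalities hold pointwise. For $\alpha\in(0,n)$ the function $g_\alpha:(0,\infty)\to[0,\infty)$ is defined by $$g_\alpha(\lambda)=\begin{cases}\frac{n}{n-2}&\text{if }0<\lambda<\frac{n-\alpha}{n-2},\\ \frac{2n-\alpha}{n-2}-\lambda&\text{if }\frac{n-\alpha}{n-2}\le\lambda<\frac{n}{n-2},\\ \max\{0,1-\frac{\alpha-2}{n}\lambda\}&\text{if }\lambda\ge\frac{n}{n-2}.\end{cases}$$ *)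

(* Defs.v *)
From HB Require Import structures.
From mathcomp Require Import all_boot all_order all_algebra.
From mathcomp Require Import all_classical all_reals all_analysis.

Set Implicit Arguments.
Unset Strict Implicit.
Unset Printing Implicit Defensive.

Import Order.TTheory GRing.Theory Num.Theory.
Import numFieldNormedType.Exports.

Local Open Scope classical_set_scope.
Local Open Scope ring_scope.

(* The library's norm on 'rV[R]_n is the sup norm; it is only used for its
   topology, and |x| is always the Euclidean norm below. *)
Definition enorm (R : realType) (n : nat) (x : 'rV[R]_n) : R :=
  Num.sqrt (\sum_(i < n) x ord0 i ^+ 2).

Section TupleProduct.
Context d (T : measurableType d) (R : realType) (n : nat).
Variable m1 : {sigma_finite_measure set T -> \bar R}.
Variable m2 : {sigma_finite_measure set (n.-tuple T) -> \bar R}.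

Definition tuple_cons (p : T * n.-tuple T) : n.+1.-tuple T :=
  [tuple of p.1 :: p.2].

Lemma measurable_tuple_cons : measurable_fun setT tuple_cons.
Proof. exact: measurable_cons. Qed.

(* product of m1 and m2, transported along T * T^n = T^(n+1) *)
Definition tuple_product : set (n.+1.-tuple T) -> \bar R :=
  pushforward (m1 \x m2)%E tuple_cons.

Let tuple_product0 : tuple_product set0 = 0%E.
Proof. by rewrite /tuple_product /pushforward preimage_set0 measure0. Qed.

Let tuple_product_ge0 A : (0 <= tuple_product A)%E.
Proof. by rewrite /tuple_product /pushforward; exact: measure_ge0. Qed.

Let tuple_product_sigma_additive : semi_sigma_additive tuple_product.
Proof.
move=> F mF tF mUF; rewrite /tuple_product /pushforward preimage_bigcup.
apply: measure_semi_sigma_additive.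
- by move=> k; rewrite -[X in measurable X]setTI; exact: measurable_tuple_cons.
- apply/trivIsetP => /= i j _ _ ij; rewrite -preimage_setI.
  by move/trivIsetP : tF => /(_ _ _ _ _ ij) ->//; rewrite preimage_set0.
- rewrite -preimage_bigcup -[X in measurable X]setTI.
  exact: measurable_tuple_cons.
Qed.

HB.instance Definition _ := isMeasure.Build _ _ _ tuple_product
  tuple_product0 tuple_product_ge0 tuple_product_sigma_additive.

Let tuple_product_sigma_finite : sigma_finite setT tuple_product.
Proof.
have /sigma_finiteP[F [TF ndF Foo]] := sigma_finiteT m1.
have /sigma_finiteP[G [TG ndG Goo]] := sigma_finiteT m2.
pose g (t : n.+1.-tuple T) : T * n.-tuple T := (thead t, [tuple of behead t]).
have gK p : g (tuple_cons p) = p.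
  case: p => a t; rewrite /g /tuple_cons theadE; congr pair.
  exact: val_inj.
have mg : measurable_fun setT g.
  apply/measurable_fun_pair; first exact: measurable_tnth.
  exact: measurable_behead.
exists (fun k => g @^-1` (F k `*` G k)).
  rewrite -preimage_bigcup (_ : \bigcup_k _ = setT) ?preimage_setT//.
  apply/seteqP; split => // -[x y] _.
  have : (\bigcup_i F i) x by rewrite -TF.
  have : (\bigcup_i G i) y by rewrite -TG.
  move=> [j _ Gjy] [i _ Fix_]; exists (maxn i j) => //; split => /=.
  - by move: x Fix_; exact/subsetPset/ndF/leq_maxl.
  - by move: y Gjy; exact/subsetPset/ndG/leq_maxr.
move=> k; have [mF Fk] := Foo k; have [mG Gk] := Goo k; split.
  by rewrite -[X in measurable X]setTI; apply: mg => //; exact: measurableX.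
rewrite /tuple_product /pushforward -comp_preimage.
rewrite (_ : g \o tuple_cons = idfun); last exact/funext.
by rewrite product_measure1E// lte_mul_pinfty// ge0_fin_numE.
Qed.

HB.instance Definition _ := Measure_isSigmaFinite.Build _ _ _ tuple_product
  tuple_product_sigma_finite.

End TupleProduct.

(* Lebesgue measure on R^n, as an iterated product: the library has it on R
   only.  The library's sigma-algebra on n.-tuple is the one generated by the
   coordinate projections, here the Borel sets of R^n. *)
Fixpoint lebesgue_tuple (R : realType) (n : nat) :
    {sigma_finite_measure set (n.-tuple (measurableTypeR R)) -> \bar R} :=
  match n with
  | 0 => dirac [tuple]
  | m.+1 => tuple_product (@lebesgue_measure R) (lebesgue_tuple R m)
  end.

Lemma lebesgue_tuple_box (R : realType) (n : nat)
    (A : 'I_n -> set (measurableTypeR R)) :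
  (forall i, measurable (A i)) ->
  lebesgue_tuple R n [set t | forall i, A i (tnth t i)] =
  (\prod_(i < n) lebesgue_measure (A i))%E.
Proof.
elim: n A => [|n IH] A mA.
  by rewrite big_ord0 /= diracE mem_set// => -[].
rewrite big_ord_recl -IH; last by move=> i; exact: mA.
rewrite /= /tuple_product /pushforward.
rewrite (_ : _ @^-1` _ =
    A ord0 `*` [set t | forall i, A (lift ord0 i) (tnth t i)]).
  rewrite product_measure1E//.
  rewrite (_ : [set _ | _] = \bigcap_(i in setT)
      ((fun t => tnth t i) @^-1` A (lift ord0 i))).
    apply: fin_bigcap_measurable => //.
    by move=> i _; rewrite -[X in measurable X]setTI; apply: measurable_tnth.
  by apply/seteqP; split => t /= => [h i _|h i]; apply: h.
apply/seteqP; split => -[x t] /=.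
  move=> h; split; first exact: (h ord0).
  by move=> i; have := h (lift ord0 i); rewrite tnthS.
move=> [h0 h] i; case: (unliftP ord0 i) => [j ->|-> //].
by rewrite tnthS.
Qed.

Definition rV_of_tuple (R : realType) (n : nat)
    (t : n.-tuple (measurableTypeR R)) : 'rV[R]_n :=
  \row_(i < n) tnth t i.

Definition integral_Rn (R : realType) (n : nat) (f : 'rV[R]_n -> \bar R) :
    \bar R :=
  (\int[lebesgue_tuple R n]_t f (rV_of_tuple t))%E.

(* Membership in L^p(R^n) for a real p > 0, possibly p < 1. *)
Definition in_Lp (R : realType) (n : nat) (p : R) (u : 'rV[R]_n -> R) : Prop :=
  measurable_fun setT (fun t => u (@rV_of_tuple R n t) : measurableTypeR R) /\
  (integral_Rn (fun y => (`|u y| `^ p)%:E) < +oo)%E.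

Definition partial (R : realType) (n : nat) (i : 'I_n) (u : 'rV[R]_n -> R) :
    'rV[R]_n -> R :=
  'D_(delta_mx ord0 i) u.

(* A is meant to be open *)
Definition C1_on (R : realType) (n : nat) (A : set 'rV[R]_n)
    (u : 'rV[R]_n -> R) : Prop :=
  (forall x, A x -> {for x, continuous u}) /\
  (forall (i : 'I_n) x, A x ->
    derivable u x (delta_mx ord0 i) /\ {for x, continuous (partial i u)}).

Definition C2_on (R : realType) (n : nat) (A : set 'rV[R]_n)
    (u : 'rV[R]_n -> R) : Prop :=
  C1_on A u /\ (forall i : 'I_n, C1_on A (partial i u)).

Definition laplacian (R : realType) (n : nat) (u : 'rV[R]_n -> R) :
    'rV[R]_n -> R :=
  fun x => \sum_(i < n) partial i (partial i u) x.

(* (|x|^-alpha * u^lambda)(x), as an extended real.  At the single point y = x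
   the integrand is 0 since division by 0 yields 0; points are null sets. *)
Definition riesz_conv (R : realType) (n : nat) (alpha lambda : R)
    (u : 'rV[R]_n -> R) (x : 'rV[R]_n) : \bar R :=
  integral_Rn (fun y => (u y `^ lambda / enorm (x - y) `^ alpha)%:E).

Definition g_exp (R : realType) (n : nat) (alpha lambda : R) : R :=
  if lambda < (n%:R - alpha) / (n%:R - 2) then n%:R / (n%:R - 2)
  else if lambda < n%:R / (n%:R - 2) then
    (2 * n%:R - alpha) / (n%:R - 2) - lambda
  else Num.max 0 (1 - (alpha - 2) / n%:R * lambda).

(* Main.v *)
(* With m = (n - 2) / 2, continue t^-m below t = 1 by its second order Taylor
   polynomial at 1; composed with |x|^2 this is C2, and its Laplacian is
   -kappa (1 - |x|^2)_+.  The difference of two rescaled copies with the same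
   harmonic tail is a C2 function supported in a ball of radius d_j, of height
   about r_j^-S on a ball of radius r_j << d_j, whose Laplacian is bounded by
   kappa r_j^(-S-2) in the small ball and is tiny outside.  Place such bumps,
   with disjoint supports, at points converging to 0, and add the background
   16 (1 - |x|^2 / rho)_+^3, whose strict superharmonicity on B_2 absorbs the
   positive part of the Laplacian of the bumps.  Outside the small balls the
   inequality holds because rho is large; inside, it reduces to an inequality
   between powers of r_j, which holds for small r_j for a suitable exponent S.
   The r_j are then taken so small that r_j^-S beats phi. *)

Require Import Defs.
From mathcomp Require Import all_boot all_order all_algebra.
From mathcomp Require Import all_classical all_reals all_analysis.
From mathcomp Require Import measurable_realfun.
From mathcomp Require Import ring lra.

Import Order.TTheory GRing.Theory Num.Theory.
Import numFieldNormedType.Exports.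

Local Open Scope classical_set_scope.
Local Open Scope ring_scope.

Set Implicit Arguments.
Unset Strict Implicit.
Unset Printing Implicit Defensive.

(** * Radial functions and their Laplacians *)

(** Every lambda > 0 is allowed, and the harmonic tail |x|^(2-n) is not in L^lambda at infinity when
    lambda (n - 2) <= n; hence bumps and background alike have compact support. The price is that a
    nonzero function with compact support is never superharmonic, so each bump has -Delta < 0
    somewhere. Cutting the tail by subtracting a wider copy of the same profile keeps this defect
    explicit: it is at most kappa r_j^(n-2-S) / d_j^n, as small as desired because S < n - 2. The
    background has to satisfy the inequality by itself wherever the bumps do not help. Keeping u >=
    1 on a neighbourhood of B_2 makes u^sigma >= 1 and the convolution at least n^-n, while -Delta
    of the background lies between 96 / rho and 96 n / rho on B_2. So rho is fixed in terms of n
    alone, and the r_j are chosen afterwards, depending on rho and phi. All radial functions are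
    functions of |x|^2, which avoids square roots both in the smoothness at the centres and in the
    distance estimates. *)

Lemma is_derive_lineP (R : numFieldType) (V W : normedModType R)
    (f : V -> W) (x v : V) (df : W) :
  is_derive x v f df <-> is_derive (0 : R) 1 (fun h : R => f (h *: v + x)) df.
Proof.
have E : 'D_1 (fun h : R => f (h *: v + x)) (0 : R) = 'D_v f x.
  rewrite /derive (_ : (fun h : R => h^-1 *: _) =
    (fun h : R => h^-1 *: ((f \o shift x) (h *: v) - f x)))//.
  apply/funext => h /=.
  by rewrite scale0r add0r addr0 [h *: (1 : R)]mulr1.
split=> -[fd fE].
  by apply: DeriveDef; [exact: (proj1 (derivable1P _ _ _)) | rewrite E].
by apply: DeriveDef; [exact: (proj2 (derivable1P _ _ _)) | rewrite -E].
Qed.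

(** Restricting [g] to the line [h *: v + x] reduces this to the one-variable chain rule; only the
    derivative of [g] along [v] enters. *)
Lemma is_derive_comp1 (R : realType) (V : normedModType R) (G : R -> R)
    (g : V -> R) (x v : V) (a b : R) :
  is_derive (g x) 1 G a -> is_derive x v g b -> is_derive x v (G \o g) (a * b).
Proof.
move=> Ga gb; apply/is_derive_lineP.
apply: (is_derive1_comp (f := G) (g := fun h : R => g (h *: v + x))).
  by rewrite scale0r add0r.
exact: (proj1 (is_derive_lineP _ _ _ _)).
Qed.

Lemma is_derive_coord (R : realType) (n : nat) (x v : 'rV[R]_n) (i : 'I_n) :
  is_derive x v (fun y : 'rV[R]_n => y ord0 i) (v ord0 i).
Proof.
apply/is_derive_lineP.
have -> : (fun h : R => (h *: v + x) ord0 i) =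
    (fun h : R => h * v ord0 i + x ord0 i).
  by apply/funext => h; rewrite !mxE.
apply: is_derive_eq.
by rewrite /= [_ *: (1 : R)]mulr1 [0 *: _]mul0r add0r addr0.
Qed.

(** At the junction both pieces have a two-sided derivative [d] and a common value, so each
    difference quotient of the glued function is one of [f] or one of [g], and both tend to [d]. *)
Lemma is_derive_glue (R : realType) (f g : R -> R) (c x d : R) :
  f c = g c ->
  (x <= c -> is_derive x 1 f d) -> (c <= x -> is_derive x 1 g d) ->
  is_derive x 1 (fun t => if t <= c then f t else g t) d.
Proof.
move=> fgc fd gd; have [xc|cx|xc] := ltgtP x c.
- apply: near_eq_is_derive (fd (ltW xc)).
  by near=> y; rewrite ifT//; apply/ltW; near: y; exact: lt_nbhsl.
- apply: near_eq_is_derive (gd (ltW cx)).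
  by near=> y; rewrite ifF//; apply/negbTE; rewrite -ltNge; near: y; exact: lt_nbhsr.
- subst x; have [df vf] := fd (lexx _); have [dg vg] := gd (lexx _).
  have {vf}cf : h^-1 *: ((f \o shift c) (h *: 1) - f c) @[h --> 0^'] --> d.
    by rewrite -vf; exact: df.
  have {vg}cg : h^-1 *: ((g \o shift c) (h *: 1) - g c) @[h --> 0^'] --> d.
    by rewrite -vg; exact: dg.
  have cfg : h^-1 *: (((fun t => if t <= c then f t else g t) \o shift c) (h *: 1)
      - (if c <= c then f c else g c)) @[h --> 0^'] --> d.
    apply/cvgrPdist_lt => e e0.
    move/cvgrPdist_lt : cf => /(_ _ e0) cf; move/cvgrPdist_lt : cg => /(_ _ e0) cg.
    near=> h; rewrite lexx /=; case: ifP => _; last rewrite fgc.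
      by near: h.
    by near: h.
  split; first by apply/cvg_ex; exists d.
  exact: cvg_lim.
Unshelve. all: by end_near. Qed.

(** Squared, so that a radial function is smooth at its centre [p] as soon as its profile is. *)
Definition sqdist {R : realType} {n : nat} (p x : 'rV[R]_n) : R :=
  \sum_(i < n) (x ord0 i - p ord0 i) ^+ 2.

Lemma is_derive_sqdist (R : realType) (n : nat) (p x : 'rV[R]_n) (k : 'I_n) :
  is_derive x (delta_mx ord0 k) (sqdist p) (2 * (x ord0 k - p ord0 k)).
Proof.
have -> : sqdist p = \sum_(i < n) (fun y : 'rV[R]_n => (y ord0 i - p ord0 i) ^+ 2).
  by apply/funext => y; rewrite fct_sumE.
pose dq i := 2 * (x ord0 i - p ord0 i) * (k == i)%:R.
have H i : is_derive x (delta_mx ord0 k)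
    (fun y : 'rV[R]_n => (y ord0 i - p ord0 i) ^+ 2) (dq i).
  have c := is_derive_coord x (delta_mx ord0 k) i.
  have -> : (fun y : 'rV[R]_n => (y ord0 i - p ord0 i) ^+ 2) =
     ((fun y : 'rV[R]_n => y ord0 i) - cst (p ord0 i)) ^+ 2.
    by apply/funext => y; rewrite fctE.
  apply: is_derive_eq; rewrite /dq mxE /= subr0 fctE /= expr1 eq_sym.
  by [].
have dS := is_derive_sum H; apply: is_derive_eq dS _.
rewrite (bigD1 k)//= big1 ?addr0 /dq ?eqxx ?mulr1//.
by move=> i ik; rewrite eq_sym (negbTE ik) mulr0.
Qed.

Lemma continuous_at_add (R : realType) (T : topologicalType) (f g : T -> R) x :
  continuous_at x f -> continuous_at x g -> continuous_at x (fun y => f y + g y).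
Proof. by move=> cf cg; apply: cvgD. Qed.

Lemma continuous_at_mul (R : realType) (T : topologicalType) (f g : T -> R) x :
  continuous_at x f -> continuous_at x g -> continuous_at x (fun y => f y * g y).
Proof. by move=> cf cg; apply: cvgM. Qed.

Lemma continuous_at_comp (R : realType) (T : topologicalType) (f : T -> R)
    (g : R -> R) x :
  continuous_at x f -> continuous_at (f x) g -> continuous_at x (fun y => g (f y)).
Proof. by move=> cf cg; exact: continuous_comp cf cg. Qed.

Lemma continuous_at_coordB (R : realType) (n : nat) (p x : 'rV[R]_n) i :
  continuous_at x (fun y : 'rV[R]_n => y ord0 i - p ord0 i).
Proof.
by apply: continuous_at_add; [exact: coord_continuous|exact: cst_continuous].
Qed.

Lemma sqdist_continuous (R : realType) (n : nat) (p : 'rV[R]_n) :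
  continuous (sqdist p).
Proof.
rewrite (_ : sqdist p = (fun y => \sum_(i <- index_enum 'I_n)
    (y ord0 i - p ord0 i) * (y ord0 i - p ord0 i))); last first.
  by apply/funext => y; apply: eq_bigr => i _; rewrite expr2.
elim: (index_enum _) => [|i s IH] x.
  rewrite (_ : (fun _ => _) = cst 0); first exact: cst_continuous.
  by apply/funext => y; rewrite big_nil.
rewrite (_ : (fun _ => _) = (fun y : 'rV[R]_n => (y ord0 i - p ord0 i) * (y ord0 i - p ord0 i) +
   \sum_(i <- s) (y ord0 i - p ord0 i) * (y ord0 i - p ord0 i))); last first.
  by apply/funext => y; rewrite big_cons.
apply: continuous_at_add; last exact: IH.
by apply: continuous_at_mul; exact: continuous_at_coordB.
Qed.

Definition has_C2 {R : realType} (G G1 G2 : R -> R) : Prop :=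
  [/\ forall t, is_derive (t : R) 1 G (G1 t), forall t, is_derive (t : R) 1 G1 (G2 t)
    & continuous G2].

Lemma is_derive_continuous (R : realType) (G G1 : R -> R) :
  (forall t, is_derive (t : R) 1 G (G1 t)) -> continuous G.
Proof.
move=> dG t; apply: differentiable_continuous; apply/derivable1_diffP.
exact: (@ex_derive _ _ _ _ _ _ _ (dG t)).
Qed.

Section Radial.
Context (R : realType) (n : nat) (p : 'rV[R]_n) (G G1 G2 : R -> R).
Context (GC2 : has_C2 G G1 G2).

Let f := G \o sqdist p.

Lemma partial_radial i :
  partial i f = (fun x => 2 * (x ord0 i - p ord0 i) * G1 (sqdist p x)).
Proof.
case: GC2 => dG _ _; apply/funext => x; rewrite /partial.
have dq := is_derive_sqdist p x i; have dGx := dG (sqdist p x).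
have [_ ->] := is_derive_comp1 dGx dq.
by rewrite mulrC.
Qed.

Lemma is_derive_partial_radial i j x :
  is_derive x (delta_mx ord0 j) (partial i f)
    (2 * (i == j)%:R * G1 (sqdist p x) +
     4 * (x ord0 i - p ord0 i) * (x ord0 j - p ord0 j) * G2 (sqdist p x)).
Proof.
case: GC2 => _ dG _; rewrite partial_radial.
have dq := is_derive_sqdist p x j; have dGx := dG (sqdist p x).
have dc := is_derive_comp1 dGx dq.
have c := is_derive_coord x (delta_mx ord0 j) i.
have -> : (fun x : 'rV[R]_n => 2 * (x ord0 i - p ord0 i) * G1 (sqdist p x)) =
   ((2 : R) *: ((fun y : 'rV[R]_n => y ord0 i) - cst (p ord0 i))) * (G1 \o sqdist p).
  by apply/funext => y; rewrite !fctE.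
apply: is_derive_eq; rewrite mxE /= subr0 !fctE /GRing.scale /= eq_sym.
by ring.
Qed.

Lemma continuous_partial2_radial i j : continuous (partial j (partial i f)).
Proof.
have -> : partial j (partial i f) = fun x =>
    2 * (i == j)%:R * G1 (sqdist p x) +
     4 * (x ord0 i - p ord0 i) * (x ord0 j - p ord0 j) * G2 (sqdist p x).
  by apply/funext => x; have [_ <-] := is_derive_partial_radial i j x.
case: GC2 => _ /is_derive_continuous cG1 cG2 x.
have cq := @sqdist_continuous _ _ p x.
have cx k := @continuous_at_coordB _ _ p x k.
apply: continuous_at_add.
  apply: continuous_at_mul; first exact: cst_continuous.
  exact: continuous_comp cq (cG1 _).
apply: continuous_at_mul; last exact: continuous_comp cq (cG2 _).
by do 2 (apply: continuous_at_mul => //); exact: cst_continuous.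
Qed.

Lemma continuous_partial_radial i : continuous (partial i f).
Proof.
rewrite partial_radial; case: GC2 => _ /is_derive_continuous cG1 cG2 x.
have cq := @sqdist_continuous _ _ p x.
apply: continuous_at_mul; last exact: continuous_comp cq (cG1 _).
apply: continuous_at_mul; first exact: cst_continuous.
exact: continuous_at_coordB.
Qed.

Lemma continuous_radial : continuous f.
Proof.
case: GC2 => /is_derive_continuous cG _ _ x.
by apply: continuous_comp; [exact: sqdist_continuous|exact: cG].
Qed.

Lemma C2_on_radial A : C2_on A f.
Proof.
case: (GC2) => dG _ _; split; first split.
- by move=> x _; exact: continuous_radial.
- move=> i x _; split; last exact: continuous_partial_radial.
  have dq := is_derive_sqdist p x i.
  by have [] := is_derive_comp1 (dG (sqdist p x)) dq.
- move=> i; split; first by move=> x _; exact: continuous_partial_radial.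
  move=> j x _; split; last exact: continuous_partial2_radial.
  by have [] := is_derive_partial_radial i j x.
Qed.

Lemma laplacian_radial x :
  laplacian f x = 2 * n%:R * G1 (sqdist p x) + 4 * sqdist p x * G2 (sqdist p x).
Proof.
rewrite /laplacian.
under eq_bigr => i _.
  rewrite [partial _ _ _](_ : _ = 2 * G1 (sqdist p x) +
      4 * (x ord0 i - p ord0 i) ^+ 2 * G2 (sqdist p x)); last first.
    have [_ H] := is_derive_partial_radial i i x; by rewrite /partial H eqxx mulr1 expr2 !mulrA.
  over.
rewrite big_split /= sumr_const card_ord -mulr_suml -mulr_sumr.
by rewrite -[_ *+ n]mulr_natr /sqdist; ring.
Qed.

End Radial.

(** * Sums of C2 functions, and locality of C2 and of the Laplacian *)

Lemma partialD (R : realType) (n : nat) (f g : 'rV[R]_n -> R) (i : 'I_n) :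
  C1_on setT f -> C1_on setT g ->
  partial i (f \+ g) = partial i f \+ partial i g.
Proof.
move=> [_ Cf] [_ Cg]; apply/funext => x; rewrite /partial.
by apply: deriveD; [have [] := Cf i x I|have [] := Cg i x I].
Qed.

Lemma C1_onD (R : realType) (n : nat) (f g : 'rV[R]_n -> R) :
  C1_on setT f -> C1_on setT g -> C1_on setT (f \+ g).
Proof.
move=> Cf' Cg'; have [Cf Cf1] := Cf'; have [Cg Cg1] := Cg'.
split=> [x _|i x _].
  by apply: continuousD; [exact: Cf|exact: Cg].
have [df cf] := Cf1 i x I; have [dg cg] := Cg1 i x I.
split; first exact: derivableD.
rewrite (partialD i Cf' Cg'); exact: continuousD cf cg.
Qed.

Lemma C2_onD (R : realType) (n : nat) (f g : 'rV[R]_n -> R) :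
  C2_on setT f -> C2_on setT g -> C2_on setT (f \+ g).
Proof.
move=> [Cf Cf2] [Cg Cg2]; split; first exact: C1_onD Cf Cg.
by move=> i; rewrite (partialD i Cf Cg); exact: C1_onD (Cf2 i) (Cg2 i).
Qed.

Lemma laplacianD (R : realType) (n : nat) (f g : 'rV[R]_n -> R) :
  C2_on setT f -> C2_on setT g ->
  laplacian (f \+ g) = laplacian f \+ laplacian g.
Proof.
move=> [Cf Cf2] [Cg Cg2]; apply/funext => x.
rewrite /laplacian /= -big_split; apply: eq_bigr => i _.
by rewrite (partialD i Cf Cg) (partialD i (Cf2 i) (Cg2 i)).
Qed.

Lemma near_eq_partial (R : realType) (n : nat) (f g : 'rV[R]_n -> R)
    (i : 'I_n) (x : 'rV[R]_n) :
  (\near x, f x = g x) -> \near x, partial i f x = partial i g x.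
Proof.
move=> /near_join fg; near=> y; apply: near_eq_derive.
by near: y.
Unshelve. all: by end_near. Qed.

Lemma near_eq_laplacian (R : realType) (n : nat) (f g : 'rV[R]_n -> R)
    (x : 'rV[R]_n) :
  (\near x, f x = g x) -> laplacian f x = laplacian g x.
Proof.
move=> fg; apply: eq_bigr => i _.
apply: (@nbhs_singleton _ x (fun y => _ y = _ y)).
by do 2 apply: near_eq_partial.
Qed.

Lemma near_eq_C1 (R : realType) (n : nat) (f g : 'rV[R]_n -> R)
    (x : 'rV[R]_n) :
  (\near x, f x = g x) -> C1_on setT g -> C1_on [set x] f.
Proof.
move=> fg [Cg Cg1].
have cts (h k : 'rV[R]_n -> R) : (\near x, h x = k x) ->
    {for x, continuous k} -> {for x, continuous h}.
  move=> hk ck; rewrite /prop_for /continuous_at (nbhs_singleton hk).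
  apply: cvg_trans ck; apply: (@near_eq_cvg _ _ (nbhs x) _ k h).
  by near=> y; symmetry; near: y.
split=> [_ ->|i _ ->]; first exact: cts fg (Cg _ I).
have [dg cg] := Cg1 i x I.
split; last exact: cts (near_eq_partial _ fg) cg.
apply: near_eq_derivable dg.
by near=> y; symmetry; near: y.
Unshelve. all: by end_near. Qed.

Lemma near_eq_C2 (R : realType) (n : nat) (f g : 'rV[R]_n -> R)
    (x : 'rV[R]_n) :
  (\near x, f x = g x) -> C2_on setT g -> C2_on [set x] f.
Proof.
move=> fg [Cg Cg2]; split; first exact: near_eq_C1 fg Cg.
by move=> i; apply: near_eq_C1 (Cg2 i); exact: near_eq_partial.
Qed.

(** [C1_on] and [C2_on] speak of the points of [A] one at a time, so a different local model of [f]
    can be used at each point. *)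
Lemma C2_on_points (R : realType) (n : nat) (A : set 'rV[R]_n)
    (f : 'rV[R]_n -> R) :
  (forall x, A x -> C2_on [set x] f) -> C2_on A f.
Proof.
move=> Cf; split; first split.
- by move=> x /Cf[[+ _] _]; apply.
- by move=> i x /Cf[[_ +] _]; apply.
- move=> i; split.
  + by move=> x /Cf[_ /(_ i)[+ _]]; apply.
  + by move=> j x /Cf[_ /(_ i)[_ +]]; apply.
Qed.

(** * The superharmonic profile *)

Lemma has_C2_affine (R : realType) (G G1 G2 : R -> R) (H a b : R) :
  has_C2 G G1 G2 ->
  has_C2 (fun t => H * G (a * t + b)) (fun t => H * a * G1 (a * t + b))
    (fun t => H * a ^+ 2 * G2 (a * t + b)).
Proof.
move=> [dG dG1 cG2].
have daff t : is_derive (t : R) 1 (fun t => a * t + b) a.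
  by apply: is_derive_eq; rewrite [_ *: (1 : R)]mulr1 addr0.
have K (F F1 : R -> R) (c t : R) : (forall t, is_derive (t : R) 1 F (F1 t)) ->
    is_derive t 1 (fun t => c * F (a * t + b)) (c * a * F1 (a * t + b)).
  move=> dF.
  have dc := is_derive1_comp (g := fun t => a * t + b) (dF (a * t + b)) (daff t).
  rewrite (_ : (fun _ => _) = c *: (F \o (fun t => a * t + b)))//.
  by apply: is_derive_eq; rewrite /GRing.scale /=; ring.
split.
- by move=> t; exact: K.
- by move=> t; rewrite expr2 mulrA; exact: K.
- move=> t; apply: continuous_at_mul; first exact: cst_continuous.
  apply: (@continuous_at_comp _ _ (fun t => a * t + b) G2); last exact: cG2.
  exact: is_derive_continuous daff t.
Qed.

Lemma has_C2_add (R : realType) (F F1 F2 G G1 G2 : R -> R) :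
  has_C2 F F1 F2 -> has_C2 G G1 G2 ->
  has_C2 (fun t => F t + G t) (fun t => F1 t + G1 t) (fun t => F2 t + G2 t).
Proof.
move=> [dF dF1 cF2] [dG dG1 cG2]; split => t.
- by have dFt := dF t; have dGt := dG t; exact: is_deriveD.
- by have dFt := dF1 t; have dGt := dG1 t; exact: is_deriveD.
- by apply: continuous_at_add; [exact: cF2|exact: cG2].
Qed.

Lemma continuous_powR (R : realType) (a t : R) : 0 < t ->
  continuous_at t (fun s : R => s `^ a).
Proof.
move=> t0; apply: differentiable_continuous; apply/derivable1_diffP.
exact: (@ex_derive _ _ _ _ _ _ _ (is_derive1_powR a t0)).
Qed.

Lemma is_derive_affine (R : realType) (a b c t : R) :
  is_derive t 1 (fun s => b + a * (s - c)) a.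
Proof.
rewrite (_ : (fun _ => _) = fun s => a * s + (b - a * c)).
  by apply: is_derive_eq; rewrite [_ *: (1 : R)]mulr1 addr0.
by apply/funext => s; ring.
Qed.

Lemma is_derive_quadratic (R : realType) (a b d c t : R) :
  is_derive t 1 (fun s => b + a * (s - c) + d / 2 * (s - c) ^+ 2) (a + d * (t - c)).
Proof.
have d1 := is_derive_affine 1 0 c t.
have d2 := is_derive_affine a b c t.
rewrite (_ : (fun s => b + a * (s - c) + d / 2 * (s - c) ^+ 2) =
  (fun s => b + a * (s - c)) +
  d / 2 *: ((fun s : R => 0 + 1 * (s - c)) ^+ 2)); last first.
  by apply/funext => s; rewrite !fctE /= add0r mul1r.
have d5 := is_deriveD d2 (is_deriveZ (d / 2) (is_deriveX 2 d1)).
apply: is_derive_eq d5 _.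
by rewrite /GRing.scale /= expr1; field.
Qed.

Section Profile.
Context (R : realType) (m : R).

(* t^-m for t >= 1, continued below 1 by its second order Taylor polynomial
   at 1; for m = (n - 2) / 2 the function x |-> profile m |x|^2 is C2,
   superharmonic, and harmonic outside the unit ball. *)
Definition profile (t : R) : R :=
  if t <= 1 then 1 - m * (t - 1) + m * (m + 1) / 2 * (t - 1) ^+ 2
  else t `^ (- m).

Definition profile1 (t : R) : R :=
  if t <= 1 then - m + m * (m + 1) * (t - 1) else - m * t `^ (- m - 1).

Definition profile2 (t : R) : R :=
  if t <= 1 then m * (m + 1) else m * (m + 1) * t `^ (- m - 1 - 1).

Lemma profile_ge1E t : 1 <= t -> profile t = t `^ (- m).
Proof.
rewrite /profile; case: ifP => // t1 t1'; have -> : t = 1 by lra.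
by rewrite powR1; ring.
Qed.

Lemma has_C2_profile : has_C2 profile profile1 profile2.
Proof.
split.
- move=> t; apply: is_derive_glue => [|t1|t1].
  + by rewrite powR1; ring.
  + rewrite /profile1 t1 (_ : (fun t : R => _) = fun s =>
      1 + (- m) * (s - 1) + m * (m + 1) / 2 * (s - 1) ^+ 2).
      exact: is_derive_quadratic.
    by apply/funext => s; rewrite mulNr.
  + have t0 : 0 < t by lra.
    have dp := is_derive1_powR (- m) t0; apply: is_derive_eq dp _.
    rewrite /profile1; case: ifP => // t1'; have -> : t = 1 by lra.
    by rewrite powR1; ring.
- move=> t; apply: is_derive_glue => [|t1|t1].
  + by rewrite powR1; ring.
  + by rewrite /profile2 t1; exact: is_derive_affine.
  + have t0 : 0 < t by lra.
    have dp := is_derive1_powR (- m - 1) t0.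
    have -> : (fun t : R => - m * t `^ (- m - 1)) = - m *: (powR (R:=R))^~ (- m - 1).
      by apply/funext => s.
    apply: is_derive_eq (is_deriveZ (- m) dp) _.
    rewrite /profile2; case: ifP => [t1'|_]; last by rewrite /GRing.scale /=; ring.
    have -> : t = 1 by lra.
    by rewrite !powR1 /GRing.scale /=; ring.
- move=> t.
  (* [(t + 1 + |t - 1|) / 2] is the maximum of [t] and 1, so one continuous formula covers both
     branches. *)
  rewrite (_ : profile2 = fun t =>
      m * (m + 1) * (2^-1 * (t + 1 + `|t + (-1)|)) `^ (- m - 1 - 1)); last first.
    apply/funext => s; rewrite /profile2; case: ifP => s1.
      rewrite ler0_norm; last lra.
      have -> : 2^-1 * (s + 1 + - (s + -1)) = 1 by field.
      by rewrite powR1 mulr1.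
    rewrite ger0_norm; last lra.
    by have -> : 2^-1 * (s + 1 + (s + -1)) = s by field.
  apply: continuous_at_mul; first exact: cst_continuous.
  have c1 : continuous_at t (fun y : R => y + (-1)).
    by apply: continuous_at_add; [exact: cvg_id|exact: cst_continuous].
  have c2 : continuous_at t (fun y : R => 2^-1 * (y + 1 + `|y + (-1)|)).
    apply: continuous_at_mul; first exact: cst_continuous.
    apply: continuous_at_add; last exact: continuous_at_comp c1 (@norm_continuous _ _ _).
    by apply: continuous_at_add; [exact: cvg_id|exact: cst_continuous].
  apply: continuous_at_comp c2 (@continuous_powR _ _ _ _).
  have := ler_norm (- (t + -1)); rewrite normrN; lra.
Qed.

(** For n = 2m + 2, |x|^(-2m) is the fundamental solution up to a factor, whence 0 for t >= 1. For t
    <= 1 the left side is affine in [t] and vanishes at 1, because the second derivatives of the two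
    pieces agree there. *)
Lemma profile_radial (n : R) t : n = 2 * m + 2 -> 0 <= t ->
  2 * n * profile1 t + 4 * t * profile2 t =
  - (2 * n * m * (m + 2) * Num.max 0 (1 - t)).
Proof.
move=> -> t0; rewrite /profile1 /profile2; case: ifP => t1.
  by rewrite max_r; [ring|lra].
have t0' : 0 < t by lra.
rewrite max_l; last lra.
rewrite (_ : t `^ (- m - 1) = t * t `^ (- m - 1 - 1)); first by ring.
by rewrite -{2}(powRr1 t0) -powRD ?(gt_eqF t0') ?implybT//; congr (_ `^ _); ring.
Qed.

Lemma profile_coef_ge0 : 0 < m -> 0 <= m * (m + 1) / 2.
Proof. by move=> m0; apply: divr_ge0 => //; apply: mulr_ge0; lra. Qed.

Lemma profile_quad_ge0 (t : R) : 0 < m -> 0 <= m * (m + 1) / 2 * (t - 1) ^+ 2.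
Proof. by move=> m0; rewrite mulr_ge0 ?sqr_ge0 ?profile_coef_ge0. Qed.

Lemma profile_gt0 (t : R) : 0 < m -> 0 <= t -> 0 < profile t.
Proof.
move=> m0 t0; rewrite /profile; case: ifP => t1; last by apply: powR_gt0; lra.
have := profile_quad_ge0 t m0; nra.
Qed.

Lemma profile_le1_ge1 (t : R) : 0 < m -> t <= 1 -> 1 <= profile t.
Proof.
move=> m0 t1; rewrite /profile t1.
have := profile_quad_ge0 t m0; nra.
Qed.

(** The value of [profile] at 0, where it is largest on the half-line t >= 0. *)
Definition profile_sup : R := 1 + m + m * (m + 1) / 2.

Lemma profile_le_sup (t : R) : 0 < m -> 0 <= t -> profile t <= profile_sup.
Proof.
move=> m0 t0; rewrite /profile_sup /profile; case: ifP => t1.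
  have h : (t - 1) ^+ 2 <= 1 by rewrite expr2; nra.
  have := ler_wpM2l (profile_coef_ge0 m0) h; rewrite mulr1; nra.
have : t `^ (- m) <= t `^ 0 by apply: ler_powR; lra.
have := profile_coef_ge0 m0; rewrite powRr0; lra.
Qed.

Lemma profile_le_powR (t : R) : 0 < m -> 0 < t -> profile t <= profile_sup * t `^ (- m).
Proof.
move=> m0 t0; have s1 : 1 <= profile_sup.
  by have := profile_coef_ge0 m0; rewrite /profile_sup; lra.
case: (leP t 1) => t1.
  apply: (le_trans (profile_le_sup m0 (ltW t0))); rewrite ler_peMr; [by []|lra|].
  rewrite powRN invf_ge1 ?powR_gt0//.
  have : t `^ m <= 1 `^ m by apply: ge0_ler_powR; rewrite ?nnegrE; lra.
  by rewrite powR1.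
rewrite profile_ge1E; last lra.
by rewrite ler_peMl// powR_ge0.
Qed.

(** Meant for points within one core radius of a point of the core: their squared distance to the
    centre is at most 4 times the squared core radius. *)
Lemma profile_ge_powR4 (t : R) : 0 < m -> 0 <= t -> t <= 4 -> 4 `^ (- m) <= profile t.
Proof.
move=> m0 t0 t4; case: (leP t 1) => t1.
  apply: le_trans (profile_le1_ge1 m0 t1).
  have : (4 : R) `^ (- m) <= 4 `^ 0 by apply: ler_powR; lra.
  by rewrite powRr0.
rewrite profile_ge1E; last exact: ltW.
rewrite !powRN lef_pV2 ?posrE ?powR_gt0//; last lra.
by apply: ge0_ler_powR; rewrite ?nnegrE; lra.
Qed.

End Profile.

(** The cube is the lowest integer power whose positive part is C2. *)
Definition cubep {R : realType} (t : R) : R := if t <= 0 then 0 else t ^+ 3.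

(** The second derivative, 6 times the positive part of [t], is written with [|t|] so that its
    continuity is immediate. *)
Lemma has_C2_cubep (R : realType) :
  has_C2 (@cubep R) (fun t => if t <= 0 then 0 else 3 * t ^+ 2)
    (fun t => 3 * (t + `|t|)).
Proof.
split=> t.
- apply: is_derive_glue => [|t0|t0]; first by rewrite expr0n.
    by rewrite t0; exact: is_derive_cst.
  have -> : (fun t : R => t ^+ 3) = id ^+ 3 by apply/funext.
  apply: is_derive_eq; rewrite /GRing.scale /= mulr1; case: ifP => // t0'.
  by rewrite (_ : t = 0) ?expr0n ?mulr0//; lra.
- apply: is_derive_glue => [|t0|t0]; first by rewrite expr0n mulr0.
    by rewrite ler0_norm// subrr mulr0; exact: is_derive_cst.
  have -> : (fun t : R => 3 * t ^+ 2) = (3 : R) *: id ^+ 2 by apply/funext.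
  apply: is_derive_eq; rewrite /GRing.scale /= mulr1 expr1 ger0_norm//; ring.
- apply: continuous_at_mul; first exact: cst_continuous.
  by apply: continuous_at_add; [exact: cvg_id|exact: norm_continuous].
Qed.

(** * Integrals over boxes *)

Lemma enormB (R : realType) (n : nat) (x y : 'rV[R]_n) :
  enorm (x - y) = Num.sqrt (sqdist x y).
Proof.
congr (Num.sqrt _); apply: eq_bigr => i _; rewrite !mxE.
by rewrite -sqrrN opprB.
Qed.

Lemma measurable_sqdist (R : realType) (n : nat) (p : 'rV[R]_n) :
  measurable_fun setT (fun t => sqdist p (@rV_of_tuple R n t) : measurableTypeR R).
Proof.
apply: measurable_sum => i; apply: measurable_funX.
apply: measurable_funB => //.
rewrite (_ : (fun _ => _) = fun t => tnth t i); first exact: measurable_tnth.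
by apply/funext => t; rewrite mxE.
Qed.

Lemma measurable_radial (R : realType) (n : nat) (p : 'rV[R]_n) (G : R -> R) :
  continuous G ->
  measurable_fun setT
    (fun t => G (sqdist p (@rV_of_tuple R n t)) : measurableTypeR R).
Proof.
move=> cG; apply: (measurableT_comp (continuous_measurable_fun cG)).
exact: measurable_sqdist.
Qed.

Definition box {R : realType} {n : nat} (a : 'I_n -> R) (r : R) :
    set (n.-tuple (measurableTypeR R)) :=
  [set t | forall i, `]a i, a i + r[%classic (tnth t i)].

Lemma measurable_box (R : realType) (n : nat) (a : 'I_n -> R) r :
  measurable (box a r).
Proof.
rewrite (_ : box a r = \bigcap_(i in setT)
    ((fun t => tnth t i) @^-1` `]a i, a i + r[%classic)).
  apply: fin_bigcap_measurable => //.
  by move=> i _; rewrite -[X in measurable X]setTI; apply: measurable_tnth.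
by apply/seteqP; split => t /= => [h i _|h i]; apply: h.
Qed.

Lemma measure_box (R : realType) (n : nat) (a : 'I_n -> R) (r : R) : 0 < r ->
  lebesgue_tuple R n (box a r) = (r ^+ n)%:E.
Proof.
move=> r0; rewrite /box
  (lebesgue_tuple_box (A := fun i => `]a i, a i + r[%classic)) //.
under eq_bigr => i _.
  rewrite lebesgue_measure_itv /= lte_fin ltrDl r0 -EFinB addrAC subrr add0r.
  over.
by rewrite prodEFin prodr_const card_ord.
Qed.

(** The integral is restricted to a cube of side rho / n with a corner at [x]: its volume is
    explicit, and it stays within distance rho of [x] since n (rho / n)^2 <= rho^2. The cube is
    open, so it avoids y = x, where the kernel has the default value 0. *)
Lemma riesz_conv_ge (R : realType) (n : nat) (alpha lambda : R)
    (u : 'rV[R]_n -> R) (x : 'rV[R]_n) (rho L : R) :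
  (0 < n)%N -> 0 < alpha -> 0 <= lambda -> 0 < rho -> 0 <= L ->
  measurable_fun setT (fun t => u (@rV_of_tuple R n t) : measurableTypeR R) ->
  (forall y, sqdist x y <= rho ^+ 2 -> L <= u y) ->
  ((L `^ lambda * rho `^ (- alpha) * (rho / n%:R) ^+ n)%:E <=
    riesz_conv alpha lambda u x)%E.
Proof.
move=> n0 al0 la0 rho0 L0 mu Lu.
have n0' : 0 < n%:R :> R by rewrite ltr0n.
have r0 : 0 < rho / n%:R by rewrite divr_gt0.
pose B := box (fun i => x ord0 i) (rho / n%:R).
have mB : measurable B by exact: measurable_box.
have -> : (L `^ lambda * rho `^ (- alpha) * (rho / n%:R) ^+ n)%:E =
    (\int[lebesgue_tuple R n]_t (L `^ lambda * rho `^ (- alpha) * \1_B t)%:E)%E.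
  under eq_integral do rewrite EFinM.
  rewrite ge0_integralZl_EFin //; last 2 first.
  - by apply/measurable_EFinP; exact: measurable_indic.
  - by rewrite mulr_ge0 ?powR_ge0.
  rewrite integral_indic// setIT EFinM; congr (_ * _)%E.
  by symmetry; exact: measure_box.
apply: ge0_le_integral => //.
- by move=> t _; rewrite lee_fin !mulr_ge0 ?powR_ge0// indicE.
- apply/measurable_EFinP; apply: measurable_funM => //; exact: measurable_indic.
- apply/measurable_EFinP; apply: measurable_funM.
    exact: (measurableT_comp (measurable_powR _) mu).
  under eq_fun do rewrite -powRN enormB.
  apply: (measurableT_comp (measurable_powR _)).
  apply: measurable_radial; exact: sqrt_continuous.
move=> t _; rewrite lee_fin indicE; have [tB|tB] := boolP (t \in B); last first.
  by rewrite mulr0 mulr_ge0 ?powR_ge0// invr_ge0 powR_ge0.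
rewrite mulr1; move: tB; rewrite inE => tB; set y := rV_of_tuple t.
have yx i : 0 < y ord0 i - x ord0 i < rho / n%:R.
  by have := tB i; rewrite /= in_itv /= mxE => /andP[? ?]; apply/andP; split; lra.
have q_le : sqdist x y <= rho ^+ 2.
  have n1 : 1 <= n%:R :> R by rewrite ler1n.
  apply: (@le_trans _ _ (\sum_(i < n) (rho / n%:R) ^+ 2)).
    apply: ler_sum => i _; have /andP[? ?] := yx i.
    by rewrite ler_sqr ?nnegrE; lra.
  rewrite sumr_const card_ord -[_ *+ n]mulr_natr.
  rewrite (_ : _ * _ = rho ^+ 2 / n%:R); last by field; lra.
  by rewrite ler_pdivrMr// ler_peMr// sqr_ge0.
have q_gt : 0 < sqdist x y.
  pose i0 := Ordinal n0; rewrite /sqdist (bigD1 i0)//=.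
  have /andP[? _] := yx i0.
  by apply: ltr_pwDl; [rewrite exprn_gt0|apply: sumr_ge0 => i _; exact: sqr_ge0].
rewrite -powRN enormB; apply: ler_pM; rewrite ?powR_ge0//.
  by rewrite ge0_ler_powR ?nnegrE// ?(le_trans L0) ?Lu.
have s0 : 0 < Num.sqrt (sqdist x y) by rewrite sqrtr_gt0.
have sr : Num.sqrt (sqdist x y) <= rho.
  by rewrite -[leRHS]ger0_norm ?(ltW rho0)// -sqrtr_sqr; exact: ler_wsqrtr.
rewrite !powRN lef_pV2 ?posrE ?powR_gt0//.
by apply: ge0_ler_powR; rewrite ?nnegrE //; exact: ltW.
Qed.

(** Wherever [f] is positive it lies below a single term of the series of the [c k * \1_(A k)],
    hence below the series, which is integrated term by term. *)
Lemma integral_lty_cover d (T : measurableType d) (R : realType)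
    (mu : {measure set T -> \bar R}) (f : T -> R) (c : nat -> R)
    (A : nat -> set T) (M : R) :
  measurable_fun setT f -> (forall t, 0 <= f t) ->
  (forall k, 0 <= c k) -> (forall k, measurable (A k)) ->
  (forall t, 0 < f t -> exists k, A k t /\ f t <= c k) ->
  (forall N, \sum_(0 <= k < N) (c k)%:E * mu (A k) <= M%:E)%E ->
  (\int[mu]_t (f t)%:E < +oo)%E.
Proof.
move=> mf f0 c0 mA fA sM.
have mg k : measurable_fun setT (fun t => (c k * \1_(A k) t)%:E).
  by apply/measurable_EFinP; apply: measurable_funM => //; exact: measurable_indic.
have g0 k t : (0 <= (c k * \1_(A k) t)%:E)%E.
  by rewrite lee_fin mulr_ge0// indicE.
apply: (@le_lt_trans _ _ (\int[mu]_t (\sum_(0 <= k <oo) (c k * \1_(A k) t)%:E))%E).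
  apply: ge0_le_integral => //.
  - by move=> t _; rewrite lee_fin.
  - exact/measurable_EFinP.
  - apply: (@ge0_emeasurable_sum _ _ _ setT (fun k t => (c k * \1_(A k) t)%:E)) => //.
  - move=> t _; have [->|ft] := eqVneq (f t) 0.
      by apply: nneseries_ge0 => k _ _.
    have [|k [Ak fk]] := fA t; first by rewrite lt0r ft f0.
    apply: (le_trans _ (nneseries_lim_ge k.+1 _)) => //.
    rewrite big_nat_recr//=; apply: (@le_trans _ _ (c k * \1_(A k) t)%:E).
      by rewrite lee_fin indicE mem_set// mulr1.
    by rewrite leeDr// sume_ge0.
rewrite integral_nneseries//.
apply: (@le_lt_trans _ _ M%:E); last exact: ltry.
apply: lime_le.
  by apply: is_cvg_nneseries => k _ _; exact: integral_ge0.
near=> N; apply: le_trans (sM N); apply: lee_sum => k _.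
under eq_integral do rewrite EFinM.
rewrite ge0_integralZl_EFin //.
  by rewrite integral_indic// setIT.
by apply/measurable_EFinP; exact: measurable_indic.
Unshelve. all: by end_near. Qed.

(** The factor [k] will be the number of boxes in the k-th shell. The partial sums have a closed
    form, namely the bound minus a nonnegative correction. *)
Lemma sum_mul_geometric_le (R : realFieldType) (q : R) (N : nat) :
  0 <= q < 1 -> \sum_(0 <= k < N) k%:R * q ^+ k <= q / (1 - q) ^+ 2.
Proof.
move=> /andP[q0 q1]; have q1' : 1 - q != 0 by rewrite subr_eq0 gt_eqF.
have -> : \sum_(0 <= k < N) k%:R * q ^+ k =
    q / (1 - q) ^+ 2 - (N%:R / (1 - q) + q / (1 - q) ^+ 2) * q ^+ N.
  elim: N => [|N IH]; first by rewrite big_nil expr0; field.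
  by rewrite big_nat_recr//= IH [q ^+ N.+1]exprS -[N.+1%:R]natr1; field.
rewrite gerBl mulr_ge0 ?exprn_ge0// addr_ge0// divr_ge0 ?exprn_ge0//; lra.
Qed.

(** * Bumps, background and locally finite sums *)

Section Bump.
Context (R : realType) (m a D H : R).

(* Difference of two rescaled profiles whose tails are the same multiple of
   t^-m: it vanishes for t >= D. *)
Definition tail_height : R := H * (a / D) `^ m.

(** The terms [+ 0] keep the affine shape of the argument in [has_C2_affine]. *)
Definition radial_bump (t : R) : R :=
  H * profile m (a^-1 * t + 0) + (- tail_height) * profile m (D^-1 * t + 0).

Definition radial_bump1 (t : R) : R :=
  H * a^-1 * profile1 m (a^-1 * t + 0) +
  (- tail_height) * D^-1 * profile1 m (D^-1 * t + 0).

Definition radial_bump2 (t : R) : R :=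
  H * a^-1 ^+ 2 * profile2 m (a^-1 * t + 0) +
  (- tail_height) * D^-1 ^+ 2 * profile2 m (D^-1 * t + 0).

Lemma has_C2_radial_bump : has_C2 radial_bump radial_bump1 radial_bump2.
Proof.
by apply: has_C2_add; apply: has_C2_affine; exact: has_C2_profile.
Qed.

Lemma tail_height_ge0 : 0 <= H -> 0 <= tail_height.
Proof. by move=> H0; rewrite mulr_ge0// powR_ge0. Qed.

Lemma radial_bump_out t : 0 < a -> a <= D -> D <= t -> radial_bump t = 0.
Proof.
move=> a0 aD Dt; rewrite /radial_bump !addr0.
have D0 : 0 < D by lra.
have t0 : 0 < t by lra.
rewrite !profile_ge1E; last 2 first.
- by rewrite mulrC ler_pdivlMr// mul1r.
- by rewrite mulrC ler_pdivlMr// mul1r; lra.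
rewrite /tail_height mulNr -mulrA [X in _ - H * X](_ : _ = (a^-1 * t) `^ (- m)).
  by rewrite subrr.
rewrite [in RHS](_ : a^-1 * t = (a / D)^-1 * (D^-1 * t)); last by field; lra.
rewrite [RHS]powRM ?invr_ge0 ?divr_ge0 ?mulr_ge0 ?invr_ge0 ?(ltW a0) ?(ltW D0) ?(ltW t0)//.
congr (_ * _).
have q0 : 0 <= a / D by rewrite divr_ge0 ?(ltW a0) ?(ltW D0).
by rewrite -[(a / D)^-1](powR_inv1 q0) -powRrM mulN1r opprK.
Qed.

Lemma radial_bump_le t : 0 < m -> 0 <= H -> 0 < a -> 0 < D -> 0 <= t ->
  radial_bump t <= H * profile m (a^-1 * t).
Proof.
move=> m0 H0 a0 D0 t0; rewrite /radial_bump !addr0 mulNr gerBl.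
rewrite mulr_ge0 ?tail_height_ge0// ltW// profile_gt0// mulr_ge0 ?invr_ge0 ?(ltW a0) ?(ltW D0)//.
Qed.

Lemma radial_bump_ge t : 0 < m -> 0 <= H -> 0 < a -> 0 < D -> 0 <= t ->
  H * profile m (a^-1 * t) - tail_height * profile_sup m <= radial_bump t.
Proof.
move=> m0 H0 a0 D0 t0; rewrite /radial_bump !addr0 mulNr lerD2l lerN2.
rewrite ler_wpM2l ?tail_height_ge0// profile_le_sup// mulr_ge0 ?invr_ge0 ?(ltW a0) ?(ltW D0)//.
Qed.

Lemma radial_bump_laplacian (n : R) t : n = 2 * m + 2 -> 0 < a -> 0 < D -> 0 <= t ->
  2 * n * radial_bump1 t + 4 * t * radial_bump2 t =
  - (2 * n * m * (m + 2) * (H / a * Num.max 0 (1 - a^-1 * t) -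
      tail_height / D * Num.max 0 (1 - D^-1 * t))).
Proof.
move=> nE a0 D0 t0.
have Pa := profile_radial nE (t := a^-1 * t).
have PD := profile_radial nE (t := D^-1 * t).
rewrite /radial_bump1 /radial_bump2 !addr0; set E := tail_height.
have -> : 2 * n * (H * a^-1 * profile1 m (a^-1 * t) +
    (- E) * D^-1 * profile1 m (D^-1 * t)) +
  4 * t * (H * a^-1 ^+ 2 * profile2 m (a^-1 * t) +
    (- E) * D^-1 ^+ 2 * profile2 m (D^-1 * t)) =
  H / a * (2 * n * profile1 m (a^-1 * t) +
           4 * (a^-1 * t) * profile2 m (a^-1 * t)) -
  E / D * (2 * n * profile1 m (D^-1 * t) +
           4 * (D^-1 * t) * profile2 m (D^-1 * t)) by ring.
rewrite Pa ?PD ?mulr_ge0 ?invr_ge0 ?(ltW a0) ?(ltW D0)//; ring.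
Qed.

End Bump.

Section Background.
Context (R : realType) (rho : R).

(** The 16 is 2 * 2^3: if rho >= 20 and |x|^2 <= 10, the base of the cube is at least 1/2 and the
    value at least 2, which leaves 1 after a bump tail of at most 1 is subtracted. *)
Definition background (t : R) : R := 16 * cubep ((- rho^-1) * t + 1).

Definition background1 (t : R) : R :=
  16 * (- rho^-1) * (if (- rho^-1) * t + 1 <= 0 then 0
                     else 3 * ((- rho^-1) * t + 1) ^+ 2).

Definition background2 (t : R) : R :=
  16 * (- rho^-1) ^+ 2 *
    (3 * ((- rho^-1) * t + 1 + `|(- rho^-1) * t + 1|)).

Lemma has_C2_background : has_C2 background background1 background2.
Proof. exact: has_C2_affine (has_C2_cubep R). Qed.

Lemma background_ge0 t : 0 <= background t.
Proof.
rewrite /background /cubep; case: ifPn => z0; first by rewrite mulr0.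
by rewrite mulr_ge0// exprn_ge0// ltW// ltNge.
Qed.

Lemma background_le t : 0 < rho -> 0 <= t -> background t <= 16.
Proof.
move=> r0 t0; rewrite /background /cubep; case: ifPn => z0; first by rewrite mulr0.
rewrite -ltNge in z0; rewrite ler_piMr// exprn_ile1 ?(ltW z0)//.
by rewrite gerDr mulNr oppr_le0 mulr_ge0// invr_ge0 ltW.
Qed.

Lemma background_out t : 0 < rho -> rho <= t -> background t = 0.
Proof.
move=> r0 t0; rewrite /background /cubep ifT ?mulr0//.
by rewrite mulNr addrC subr_le0 mulrC ler_pdivlMr// mul1r.
Qed.

Lemma background_ge2 t : 20 <= rho -> t <= 10 -> 2 <= background t.
Proof.
move=> r0 t0; rewrite /background /cubep.
have z : 2^-1 <= - rho^-1 * t + 1.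
  have : rho^-1 * t <= 2^-1 by rewrite mulrC ler_pdivrMr; lra.
  by rewrite mulNr; lra.
rewrite ifF; last by apply/negbTE; rewrite -ltNge; lra.
have : (2^-1) ^+ 3 <= (- rho^-1 * t + 1) ^+ 3.
  by apply: lerXn2r; rewrite ?nnegrE; lra.
by rewrite !exprS expr0; lra.
Qed.

(** With w = t / rho <= 1/5 the middle term is 96 / rho times (1 - w)(n (1 - w) - 4 w), a factor
    between 1 and n when n >= 3; here 96 = 2 * 16 * 3. The bound 4 on [t] is the squared radius of
    B_2. *)
Lemma background_radial (n : R) t : 3 <= n -> 20 <= rho -> 0 <= t -> t <= 4 ->
  96 / rho <= - (2 * n * background1 t + 4 * t * background2 t) <= n * (96 / rho).
Proof.
move=> n3 r20 t0 t4; rewrite /background1 /background2.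
pose w := rho^-1 * t.
have w0 : 0 <= w by rewrite mulr_ge0// invr_ge0; lra.
have w1 : w <= 5^-1 by rewrite /w mulrC ler_pdivrMr; lra.
have -> : - rho^-1 * t = - w by rewrite mulNr.
rewrite ifF; last by apply/negbTE; rewrite -ltNge; lra.
rewrite ger0_norm; last lra.
have -> : - (2 * n * (16 * - rho^-1 * (3 * (- w + 1) ^+ 2)) +
    4 * t * (16 * (- rho^-1) ^+ 2 * (3 * (- w + 1 + (- w + 1))))) =
    96 / rho * ((1 - w) * (n * (1 - w) - 4 * w)) by rewrite /w; ring.
have c0 : 0 <= 96 / rho by rewrite divr_ge0//; lra.
rewrite [n * _]mulrC; apply/andP; split.
  rewrite -[leLHS]mulr1 ler_wpM2l//.
  have : 8 / 5 <= n * (1 - w) - 4 * w by nra.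
  nra.
rewrite [leRHS]mulrC ler_wpM2l//; have : n * (1 - w) <= n by nra.
nra.
Qed.

End Background.

Lemma limn_sum_eventually (R : realType) (f : nat -> R) (N : nat) :
  (forall k, (N <= k)%N -> f k = 0) ->
  (fun M => \sum_(k < M) f k) @ \oo --> \sum_(k < N) f k.
Proof.
move=> f0; apply: cvg_near_cst; near=> M.
have NM : (N <= M)%N by near: M; exists N.
rewrite -(subnKC NM) big_split_ord /= [X in _ + X]big1 ?addr0//.
by move=> k _; apply: f0; rewrite leq_addr.
Unshelve. all: by end_near. Qed.

Lemma limn_sumE (R : realType) (f : nat -> R) (N : nat) :
  (forall k, (N <= k)%N -> f k = 0) ->
  limn (fun M => \sum_(k < M) f k) = \sum_(k < N) f k.
Proof. by move=> /limn_sum_eventually /cvg_lim ->. Qed.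

Lemma limn_sum_single (R : realType) (f : nat -> R) (j : nat) :
  (forall k, k != j -> f k = 0) -> limn (fun M => \sum_(k < M) f k) = f j.
Proof.
move=> fj; rewrite (@limn_sumE _ _ j.+1); last first.
  by move=> k jk; apply: fj; rewrite gtn_eqF.
by rewrite big_ord_recr/= big1 ?add0r// => i _; apply: fj; rewrite ltn_eqF.
Qed.

Section LocallyFiniteSum.
Context (R : realType) (n : nat) (F : 'rV[R]_n -> R) (b : nat -> 'rV[R]_n -> R).

Definition add_bumps : 'rV[R]_n -> R :=
  fun x => F x + limn (fun N => \sum_(k < N) b k x).

Context (CF : C2_on setT F) (Cb : forall k, C2_on setT (b k)).

(** Recursive pointwise sums: regularity and Laplacian follow by induction from the case of two
    summands. *)
Fixpoint partial_bumps (N : nat) : 'rV[R]_n -> R :=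
  if N is N'.+1 then partial_bumps N' \+ b N' else F.

Lemma partial_bumpsE N x : partial_bumps N x = F x + \sum_(k < N) b k x.
Proof.
by elim: N => [|N IH] /=; rewrite ?big_ord0 ?addr0// big_ord_recr/= IH addrA.
Qed.

Lemma C2_partial_bumps N : C2_on setT (partial_bumps N).
Proof. by elim: N => [|N IH]; [exact: CF|exact: C2_onD IH (Cb N)]. Qed.

Lemma laplacian_partial_bumps N x :
  laplacian (partial_bumps N) x = laplacian F x + \sum_(k < N) laplacian (b k) x.
Proof.
elim: N => [|N IH] /=; first by rewrite big_ord0 addr0.
rewrite (laplacianD (C2_partial_bumps N) (Cb N)) /= IH.
by rewrite big_ord_recr/= addrA.
Qed.

Lemma add_bumps_near x :
  (exists N, \near x, forall k, (N <= k)%N -> b k x = 0) ->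
  exists N, [/\ \near x, add_bumps x = partial_bumps N x,
    forall k, (N <= k)%N -> laplacian (b k) x = 0 &
    forall k, (N <= k)%N -> b k x = 0].
Proof.
move=> [N Nx]; exists N; split.
- apply: filterS Nx => y Ny; rewrite /add_bumps partial_bumpsE; congr (_ + _).
  by rewrite (limn_sumE Ny).
- move=> k Nk; rewrite (@near_eq_laplacian _ _ _ (cst 0)).
    rewrite /laplacian big1// => i _; rewrite /partial.
    rewrite (_ : 'D_(delta_mx ord0 i) (cst 0) = cst 0) ?derive_cst//.
    by apply/funext => y; rewrite derive_cst.
  by apply: filterS Nx => y; apply.
- exact: nbhs_singleton Nx.
Qed.

Lemma C2_on_add_bumps A :
  (forall x, A x -> exists N, \near x, forall k, (N <= k)%N -> b k x = 0) ->
  C2_on A add_bumps.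
Proof.
move=> Ab; apply: C2_on_points => x /Ab/add_bumps_near[N [Nx _ _]].
exact: near_eq_C2 Nx (C2_partial_bumps N).
Qed.

Lemma laplacian_add_bumps x :
  (exists N, \near x, forall k, (N <= k)%N -> b k x = 0) ->
  laplacian add_bumps x =
    laplacian F x + limn (fun N => \sum_(k < N) laplacian (b k) x).
Proof.
move=> /add_bumps_near[N [Nx lN _]].
rewrite (near_eq_laplacian Nx) laplacian_partial_bumps; congr (_ + _).
by rewrite (limn_sumE lN).
Qed.

End LocallyFiniteSum.

(** * Choice of the parameters *)

(* Bumps of height r^-S on balls of radius r have mass tending to 0 when
   S < n - 2 and stay in L^lambda when S * lambda < n.  The two alternatives
   give the inequality in the small ball for small r, bounding the convolution
   from below by a constant or by the contribution of that ball. *)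
Lemma exponent_choice (R : realType) (n : nat) (alpha lambda sigma : R) :
  (3 <= n)%N -> 0 < alpha < n%:R -> 0 < lambda ->
  g_exp n alpha lambda < sigma ->
  0 < sigma /\ exists S : R, [/\ 0 < S, S < n%:R - 2, S * lambda < n%:R &
    S + 2 < S * sigma \/ S + 2 + n%:R < S * (lambda + sigma) + alpha].
Proof.
move=> n3 /andP[al0 aln] la0; rewrite /g_exp.
have N3 : 3 <= n%:R :> R by rewrite ler_nat.
set N := n%:R in aln N3 *; have N2 : 0 < N - 2 by lra.
(* In each range of lambda, S is the midpoint of an open interval that is nonempty exactly because
   sigma > g. Its upper end is n - 2 in the first two ranges and n / lambda in the third; its lower
   end turns the first alternative (first range) or the second one (the others) into an equality. *)
have mid (x y : R) : x < y -> x < (x + y) / 2 < y.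
  by move=> xy; apply/andP; split; lra.
case: ifPn => [|_].
  rewrite !ltr_pdivlMr ?ltr_pdivrMr// => la sg.
  have s1 : 0 < sigma - 1 by nra.
  have [|s0 s2] := andP (mid (2 / (sigma - 1)) (N - 2) _).
    by rewrite ltr_pdivrMr//; nra.
  split; first by lra.
  move: s0 s2; set S := (_ / 2) => s0 s2.
  have S0 : 0 < S by apply: lt_trans s0; rewrite divr_gt0.
  exists S; split => //; first by nra.
  by left; move: s0; rewrite ltr_pdivrMr//; nra.
case: ifPn => [|].
  rewrite ltr_pdivlMr// ltrBlDr ltr_pdivrMr// => la sg.
  have s1 : 0 < lambda + sigma - 1 by nra.
  have [|s0 s2] := andP (mid ((N + 2 - alpha) / (lambda + sigma - 1)) (N - 2) _).
    by rewrite ltr_pdivrMr//; nra.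
  split; first by nra.
  move: s0 s2; set S := (_ / 2) => s0 s2.
  have S0 : 0 < S by apply: lt_trans s0; rewrite divr_gt0//; lra.
  exists S; split => //; first by nra.
  by right; move: s0; rewrite ltr_pdivrMr//; nra.
rewrite -leNgt ler_pdivrMr// gt_max => la /andP[sg0 sg]; split => //.
have N0 : 0 < N by lra.
have la1 : 1 < lambda by nra.
have s1 : 0 < lambda + sigma - 1 by lra.
have sg' : N - (alpha - 2) * lambda < N * sigma.
  move: sg; rewrite -(ltr_pM2l N0) (_ : N * (1 - _) = N - (alpha - 2) * lambda)//.
  by field; rewrite gt_eqF.
have [|s0 s2] := andP (mid ((N + 2 - alpha) / (lambda + sigma - 1)) (N / lambda) _).
  by rewrite ltr_pdivrMr// mulrAC ltr_pdivlMr//; nra.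
move: s0 s2; set S := (_ / 2) => s0 s2.
have S0 : 0 < S by apply: lt_trans s0; rewrite divr_gt0//; lra.
have s3 : S * lambda < N by rewrite -ltr_pdivlMr.
exists S; split => //; first by nra.
by right; move: s0; rewrite ltr_pdivrMr//; nra.
Qed.

Lemma powR_pow2E (R : realType) (e : R) (l : nat) :
  (2^-1 ^+ l) `^ e = (2^-1 `^ e) ^+ l.
Proof.
elim: l => [|l IH]; first by rewrite !expr0 powR1.
by rewrite !exprS powRM ?IH// ?exprn_ge0 ?invr_ge0.
Qed.

Lemma powR_half_lt1 (R : realType) (e : R) : 0 < e -> 2^-1 `^ e < 1.
Proof.
move=> e0; have : (2^-1 : R) `^ e < 1 `^ e.
  by apply: gt0_ltr_powR; rewrite ?nnegrE ?invr_ge0 ?invf_lt1 ?ltr1n.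
by rewrite powR1.
Qed.

Lemma powR_pow2_small (R : realType) (e : R) (C : R) : 0 < e ->
  \forall l \near \oo, C * (2^-1 ^+ l) `^ e <= 1.
Proof.
move=> e0; have z1 := powR_half_lt1 e0.
have cz : (fun l => C * (2^-1 `^ e) ^+ l) @ \oo --> C * 0.
  by apply: cvgMr; apply: cvg_expr; rewrite ger0_norm ?powR_ge0.
have := cvgr_lt _ cz 1; rewrite mulr0 => /(_ _ ltr01); apply: filterS => l.
by rewrite powR_pow2E => /ltW.
Qed.

(** With eps = 2^-l the tail height is eps^(2m - S) / D^m, so each requirement takes the form C
    eps^e <= 1 with e > 0: e is 2, 2m - S (twice), S, and for the core the gap between the two sides
    of the chosen alternative. All of them hold for large l. *)
Lemma scale_choice (R : realType) (n : nat) (m S kappa delta D V : R)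
    (alpha lambda sigma : R) :
  (0 < n)%N -> 0 < S -> S < 2 * m -> 0 < m -> 0 < kappa -> 0 < delta -> 0 < D ->
  S + 2 < S * sigma \/ S + 2 + n%:R < S * (lambda + sigma) + alpha ->
  exists l : nat, let eps : R := 2^-1 ^+ l in
    let a := eps ^+ 2 in let H := eps `^ (- S) in
  [/\ 4 * a <= D, kappa * (tail_height m a D H / D) <= delta,
     tail_height m a D H * profile_sup m <= 1, V <= H &
     (n%:R * delta + kappa) * (H / a) <= (n%:R ^+ n)^-1 * H `^ sigma \/
     (n%:R * delta + kappa) * (H / a) <= (4 `^ (- m) * H) `^ lambda *
       eps `^ (- alpha) * (eps / n%:R) ^+ n * H `^ sigma].
Proof.
move=> n0 S0 Sm m0 k0 d0 D0 core.
have N0 : 0 < n%:R :> R by rewrite ltr0n.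
have nn0 : 0 < n%:R ^+ n :> R by rewrite exprn_gt0.
have c0 : 0 < n%:R * delta + kappa by rewrite addr_gt0// mulr_gt0.
have e20 : 0 < 2 :> R by [].
have e2m : 0 < 2 * m - S by lra.
have Dm0 : 0 < D `^ m by rewrite powR_gt0.
have near1 := @powR_pow2_small R 2 (4 / D) e20.
have near2 := @powR_pow2_small R (2 * m - S) (kappa / (D `^ m * D * delta)) e2m.
have near3 := @powR_pow2_small R (2 * m - S) (profile_sup m / D `^ m) e2m.
have near4 := @powR_pow2_small R S V S0.
have near5 : \forall l \near \oo, let eps : R := 2^-1 ^+ l in
    let a := eps ^+ 2 in let H := eps `^ (- S) in
    (n%:R * delta + kappa) * (H / a) <= (n%:R ^+ n)^-1 * H `^ sigma \/
     (n%:R * delta + kappa) * (H / a) <= (4 `^ (- m) * H) `^ lambda *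
       eps `^ (- alpha) * (eps / n%:R) ^+ n * H `^ sigma.
  have K (l : nat) : let eps : R := 2^-1 ^+ l in
      (eps `^ (- S)) / eps ^+ 2 = eps `^ (- S - 2).
    move=> eps; have e0 : 0 < eps by rewrite exprn_gt0// invr_gt0.
    rewrite powRD ?(gt_eqF e0) ?implybT//; congr (_ * _).
    by rewrite powRN -powR_mulrn// ltW.
  case: core => core.
  - have e0 : 0 < S * sigma - S - 2 by lra.
    have := @powR_pow2_small R _ ((n%:R * delta + kappa) * n%:R ^+ n) e0.
    apply: filterS => l /=; set eps := 2^-1 ^+ l => le1; left.
    have ep0 : 0 < eps by rewrite exprn_gt0// invr_gt0.
    rewrite K -/eps -powRrM.
    have -> : - S - 2 = (S * sigma - S - 2) + - S * sigma by ring.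
    rewrite powRD ?(gt_eqF ep0) ?implybT// mulrA ler_wpM2r ?powR_ge0//.
    by rewrite -[leRHS]mul1r ler_pdivlMr// mulrAC.
  - pose e := S * (lambda + sigma) + alpha - n%:R - S - 2.
    have e0 : 0 < e by rewrite /e; lra.
    have four0 : 0 < (4 : R) `^ (- m * lambda) by rewrite powR_gt0.
    have := @powR_pow2_small R _
      ((n%:R * delta + kappa) * n%:R ^+ n / 4 `^ (- m * lambda)) e0.
    apply: filterS => l /=; set eps := 2^-1 ^+ l => le1; right.
    have ep0 : 0 < eps by rewrite exprn_gt0// invr_gt0.
    rewrite K -/eps powRM ?powR_ge0// -!powRrM expr_div_n.
    rewrite -[eps ^+ n]powR_mulrn ?(ltW ep0)//.
    set A := 4 `^ (- m * lambda) in four0 le1 *.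
    have -> : A * eps `^ (- S * lambda) * eps `^ (- alpha) *
        (eps `^ n%:R / n%:R ^+ n) * eps `^ (- S * sigma) =
      A / n%:R ^+ n * eps `^ (- S * lambda - alpha + n%:R - S * sigma).
      rewrite -[in RHS]mulNr !powRD ?(gt_eqF ep0) ?implybT//; ring.
    have -> : - S - 2 = e + (- S * lambda - alpha + n%:R - S * sigma).
      by rewrite /e; ring.
    rewrite powRD ?(gt_eqF ep0) ?implybT// mulrA ler_wpM2r ?powR_ge0//.
    rewrite ler_pdivlMr//; move: le1.
    rewrite (_ : _ * _ / A * _ = ((n%:R * delta + kappa) * eps `^ e * n%:R ^+ n) / A).
      by rewrite ler_pdivrMr// mul1r.
    by ring.
have : \forall l \near \oo, let eps : R := 2^-1 ^+ l in
    let a := eps ^+ 2 in let H := eps `^ (- S) in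
  [/\ 4 * a <= D, kappa * (tail_height m a D H / D) <= delta,
     tail_height m a D H * profile_sup m <= 1, V <= H &
     (n%:R * delta + kappa) * (H / a) <= (n%:R ^+ n)^-1 * H `^ sigma \/
     (n%:R * delta + kappa) * (H / a) <= (4 `^ (- m) * H) `^ lambda *
       eps `^ (- alpha) * (eps / n%:R) ^+ n * H `^ sigma].
  near=> l.
  have h1 : 4 / D * (2^-1 ^+ l) `^ 2 <= 1 by near: l.
  have h2 : kappa / (D `^ m * D * delta) * (2^-1 ^+ l) `^ (2 * m - S) <= 1.
    by near: l.
  have h3 : profile_sup m / D `^ m * (2^-1 ^+ l) `^ (2 * m - S) <= 1 by near: l.
  have h4 : V * (2^-1 ^+ l) `^ S <= 1 by near: l.
  move=> eps a H; rewrite -/eps in h1 h2 h3 h4.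
  have ep0 : 0 < eps by rewrite exprn_gt0// invr_gt0.
  have a0 : 0 < a by rewrite exprn_gt0.
  have thE : tail_height m a D H = eps `^ (2 * m - S) / D `^ m.
    rewrite /tail_height powRM ?invr_ge0 ?(ltW a0) ?(ltW D0)//.
    rewrite -[D^-1]powR_inv1 ?(ltW D0)// -powRrM mulN1r powRN mulrA; congr (_ / _).
    rewrite /a -[eps ^+ 2]powR_mulrn ?(ltW ep0)// -powRrM.
    by rewrite -powRD ?(gt_eqF ep0) ?implybT// addrC.
  split.
  - move: h1; rewrite powR_mulrn ?(ltW ep0)// mulrAC ler_pdivrMr// mul1r; exact.
  - rewrite thE; move: h2; rewrite mulrAC ler_pdivrMr ?mulr_gt0// mul1r => h.
    rewrite (_ : kappa * _ = kappa * eps `^ (2 * m - S) / (D `^ m * D)).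
      by rewrite ler_pdivrMr ?mulr_gt0// [leRHS]mulrC.
    by field; rewrite !gt_eqF.
  - by rewrite thE mulrAC [_ * profile_sup m]mulrC mulrAC.
  - by rewrite /H powRN -ler_pdivlMr ?powR_gt0// div1r in h4 *.
  - by rewrite /a /H /eps; near: l.
by move=> -[N _ /(_ N (leqnn N))]; exists N.
Unshelve. all: by end_near. Qed.

(** * The solution *)

Lemma sqdist_ge0 (R : realType) (n : nat) (p x : 'rV[R]_n) : 0 <= sqdist p x.
Proof. by apply: sumr_ge0 => i _; exact: sqr_ge0. Qed.

Lemma coord_le_sqdist (R : realType) (n : nat) (p x : 'rV[R]_n) i :
  (x ord0 i - p ord0 i) ^+ 2 <= sqdist p x.
Proof.
rewrite /sqdist (bigD1 i)//= lerDl; apply: sumr_ge0 => k _; exact: sqr_ge0.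
Qed.

Lemma coord_lt_sqdist (R : realType) (n : nat) (p x : 'rV[R]_n) i r :
  0 <= r -> sqdist p x < r ^+ 2 -> `|x ord0 i - p ord0 i| < r.
Proof.
move=> r0 /(le_lt_trans (coord_le_sqdist p x i)).
by rewrite -real_normK ?num_real// ltr_sqr ?nnegrE.
Qed.

(** Replaces the triangle inequality for squared distances. From its factor 2 come 10 = 2 * 1 + 2 *
    4, for unit balls centred in B_2, and the 4 in [4 * a j], for core-radius balls centred in the
    core. *)
Lemma sqdist_le_double (R : realType) (n : nat) (p x y : 'rV[R]_n) :
  sqdist p y <= 2 * sqdist x y + 2 * sqdist p x.
Proof.
rewrite /sqdist !mulr_sumr -big_split /=; apply: ler_sum => i _.
set a := y ord0 i; set b := x ord0 i; set c := p ord0 i.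
have := sqr_ge0 ((a - b) - (b - c)).
by rewrite !expr2; lra.
Qed.

Section Pow2.
Context {R : realType}.

Definition pw (k : nat) : R := 2^-1 ^+ k.

Lemma pw_gt0 k : 0 < pw k.
Proof. by rewrite exprn_gt0// invr_gt0. Qed.

Lemma pwS k : pw k.+1 = pw k / 2.
Proof. by rewrite /pw exprSr. Qed.

Lemma pw_le j k : (j <= k)%N -> pw k <= pw j.
Proof.
by move=> jk; apply: ler_wiXn2l => //; rewrite ?invr_ge0// invf_le1 ?ler1n.
Qed.

Lemma pw_le1 k : pw k <= 1.
Proof. by have := pw_le (leq0n k); rewrite {2}/pw expr0. Qed.

Lemma pw_small (e : R) : 0 < e -> exists N, pw N <= e.
Proof.
move=> e0; have [N _ /(_ N (leqnn N))] := powR_pow2_small e^-1 (@ltr01 R).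
rewrite /= powRr1 ?(ltW (pw_gt0 N))// mulrC ler_pdivrMr// mul1r => h.
by exists N.
Qed.

(** Dyadic scales run from the support (index [j]) inwards to the core (index [l]). For k = l the
    point is in the core, where [q] has no lower bound. *)
Lemma dyadic_shell (q : R) (j l : nat) : (j <= l)%N -> q < pw j ^+ 2 ->
  exists k, [/\ (j <= k)%N, (k <= l)%N, q < pw k ^+ 2 &
    k = l \/ (k < l)%N /\ pw k.+1 ^+ 2 <= q].
Proof.
elim: l => [|l IH].
  by rewrite leqn0 => /eqP -> q0; exists 0%N; split => //; left.
rewrite leq_eqVlt => /predU1P[-> ql|jl ql]; first by exists l.+1; split => //; left.
have [k [jk kl qk [kE|[kl' qk']]]] := IH jl ql; last first.
  by exists k; split => //; [exact: ltnW|right; split => //; exact: ltnW].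
have [ql1|ql1] := ltP q (pw l.+1 ^+ 2).
  by exists l.+1; split => //; [exact: ltnW|left].
by subst k; exists l; split => //; right.
Qed.

End Pow2.

(** The decay of the profile gives eps^-S (eps / w)^(2m), at most eps^-S (eps / w)^S = w^-S because
    S <= 2m and eps <= w. The bound is free of [eps], so integrability survives however small phi
    forces the cores to be. *)
Lemma profile_shell_bound (R : realType) (m S eps w q : R) :
  0 < m -> S <= 2 * m -> 0 < eps -> eps <= w -> w ^+ 2 <= q ->
  eps `^ (- S) * profile m ((eps ^+ 2)^-1 * q) <= profile_sup m * w `^ (- S).
Proof.
move=> m0 Sm e0 ew wq.
have w0 : 0 < w by lra.
have w20 : 0 < w ^+ 2 by rewrite exprn_gt0.
have e20 : 0 < eps ^+ 2 by rewrite exprn_gt0.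
have q0 : 0 < q by lra.
have z0 : 0 < (eps ^+ 2)^-1 * q by rewrite mulr_gt0 ?invr_gt0.
apply: (le_trans (ler_wpM2l (powR_ge0 _ _) (profile_le_powR m0 z0))).
rewrite mulrCA ler_wpM2l//.
  by have := profile_coef_ge0 m0; rewrite /profile_sup; lra.
have -> : w `^ (- S) = eps `^ (- S) * (eps / w) `^ S.
  rewrite powRM ?invr_ge0 ?(ltW e0) ?(ltW w0)// mulrA -powRD ?(gt_eqF e0) ?implybT//.
  by rewrite addNr powRr0 mul1r -powR_inv1 ?(ltW w0)// -powRrM mulN1r.
rewrite ler_wpM2l ?powR_ge0//.
have ew0 : 0 < eps / w by rewrite divr_gt0.
apply: (@le_trans _ _ ((eps / w) `^ (2 * m))); last first.
  by apply: ger_powR => //; rewrite ew0 ler_pdivrMr// mul1r.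
have -> : (eps / w) `^ (2 * m) = ((eps ^+ 2)^-1 * w ^+ 2) `^ (- m).
  rewrite (_ : (eps ^+ 2)^-1 * w ^+ 2 = ((eps / w) ^+ 2)^-1).
    have q2 : 0 <= (eps / w) ^+ 2 by rewrite exprn_ge0// ltW.
    rewrite -[((eps / w) ^+ 2)^-1](powR_inv1 q2) -powRrM mulN1r opprK.
    by rewrite -powR_mulrn ?(ltW ew0)// -powRrM.
  by rewrite expr_div_n invf_div mulrC.
rewrite !powRN lef_pV2 ?posrE ?powR_gt0 ?mulr_gt0 ?invr_gt0//.
apply: ge0_ler_powR; rewrite ?nnegrE ?mulr_ge0 ?invr_ge0 ?(ltW e20) ?(ltW w20) ?(ltW q0) ?(ltW m0) ?(ltW w0)//.
by rewrite ler_pM2l ?invr_gt0.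
Qed.

(** * Centres, radii and heights of the bumps *)

Section Construction.
Context (R : realType) (n : nat) (S rho : R) (l : nat -> nat).
Context (n3 : (3 <= n)%N).

Definition half_dim : R := (n%:R - 2) / 2.
Local Notation m := half_dim.

Definition laplacian_coef : R := 2 * n%:R * m * (m + 2).
Local Notation kappa := laplacian_coef.

Definition first_coord : 'I_n := Ordinal (leq_trans (isT : (0 < 3)%N) n3).
Local Notation i0 := first_coord.

(** The index [l j] is the only free choice in bump j; phi enters only through it. The names in
    [_sq] are squared radii, as bumps are composed with [sqdist]. *)
Definition core_radius (j : nat) : R := pw (l j).
Definition core_sq (j : nat) : R := core_radius j ^+ 2.
Definition support_sq (j : nat) : R := pw (j + 3) ^+ 2.
Definition height (j : nat) : R := core_radius j `^ (- S).
Definition bump_center (j : nat) : 'rV[R]_n := pw j.+1 *: delta_mx ord0 i0.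
Local Notation a := core_sq.
Local Notation D := support_sq.
Local Notation H := height.

Definition bump_fun (j : nat) : 'rV[R]_n -> R :=
  radial_bump m (a j) (D j) (H j) \o sqdist (bump_center j).

Definition back_fun : 'rV[R]_n -> R := background rho \o sqdist 0.

Definition solution : 'rV[R]_n -> R := add_bumps back_fun bump_fun.

Lemma dim_ge3 : 3 <= n%:R :> R.
Proof. by rewrite ler_nat. Qed.

Lemma half_dim_gt0 : 0 < m.
Proof. by have := dim_ge3; rewrite /half_dim; lra. Qed.

Lemma dimE : n%:R = 2 * m + 2.
Proof. by rewrite /half_dim; field. Qed.

Lemma laplacian_coef_gt0 : 0 < kappa.
Proof.
have m0 := half_dim_gt0; have N3 := dim_ge3.
by rewrite /laplacian_coef !mulr_gt0//; lra.
Qed.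

Lemma core_radius_gt0 j : 0 < core_radius j.
Proof. exact: pw_gt0. Qed.

Lemma core_sq_gt0 j : 0 < a j.
Proof. by rewrite exprn_gt0// core_radius_gt0. Qed.

Lemma support_sq_gt0 j : 0 < D j.
Proof. by rewrite exprn_gt0// pw_gt0. Qed.

Lemma height_gt0 j : 0 < H j.
Proof. by rewrite powR_gt0// core_radius_gt0. Qed.

Lemma height_ge1 j : 0 <= S -> 1 <= H j.
Proof.
move=> S0; rewrite /height powRN invf_ge1 ?powR_gt0 ?core_radius_gt0//.
rewrite -[leRHS](powRr0 (core_radius j)); apply: ger_powR => //.
by rewrite core_radius_gt0 pw_le1.
Qed.

Lemma center_coord j i : bump_center j ord0 i = pw j.+1 * (i == i0)%:R.
Proof. by rewrite !mxE eqxx. Qed.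

Lemma sqdist_center0 j : sqdist 0 (bump_center j) = pw j.+1 ^+ 2.
Proof.
rewrite /sqdist (bigD1 i0)//= big1 => [|i /negbTE ii0].
  by rewrite center_coord eqxx mulr1 mxE subr0 addr0.
by rewrite center_coord ii0 mulr0 mxE subr0 expr0n.
Qed.

(** The first coordinate suffices: for j < k the centres are at least 2^-(j+2) apart, while the
    radii add up to at most 2^-(j+3) + 2^-(j+4). *)
Lemma supports_disjoint j k x :
  sqdist (bump_center j) x < D j -> sqdist (bump_center k) x < D k -> j = k.
Proof.
wlog jk : j k / (j < k)%N.
  move=> W jD kD; case: (ltngtP j k) => // jk; first exact: W.
  by symmetry; exact: W.
move=> /(coord_lt_sqdist i0 (ltW (pw_gt0 _))) + /(coord_lt_sqdist i0 (ltW (pw_gt0 _))).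
rewrite !center_coord eqxx !mulr1 !ltr_norml => /andP[h1 _] /andP[_ h2].
have h3 : pw k.+1 <= pw j.+2 :> R by exact: pw_le.
have h4 : pw (k + 3) <= pw j.+4 :> R by apply: pw_le; rewrite addnS ltnS addn2 !ltnS.
have c0 : 0 < pw j.+4 :> R := pw_gt0 _.
have E1 : pw (j + 3) = 2 * pw j.+4 :> R by rewrite addn3 [pw j.+4]pwS; field.
have E2 : pw j.+2 = 2 * pw (j + 3) :> R by rewrite addn3 [pw j.+3]pwS; field.
have E3 : pw j.+1 = 2 * pw j.+2 :> R by rewrite [pw j.+2]pwS; field.
by exfalso; move: h1 h2 h3 h4 c0; rewrite E3 E2 E1; lra.
Qed.

(** On bump k every coordinate is below 2^-(k+1) + 2^-(k+3) < 2^-k in absolute value; this yields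
    local finiteness away from 0. *)
Lemma support_away k i (x : 'rV[R]_n) (eta : R) :
  eta < `|x ord0 i| -> pw k <= eta -> D k <= sqdist (bump_center k) x.
Proof.
move=> ex ke; rewrite leNgt; apply/negP => /(coord_lt_sqdist i (ltW (pw_gt0 _))) h.
have : `|x ord0 i| <= pw (k + 3) + `|bump_center k ord0 i|.
  rewrite -[x ord0 i](subrK (bump_center k ord0 i)).
  by rewrite (le_trans (ler_normD _ _))// lerD2r ltW.
have : `|bump_center k ord0 i| <= pw k.+1.
  rewrite center_coord normrM (gtr0_norm (pw_gt0 _)) ler_piMr ?(ltW (pw_gt0 _))//.
  by case: (_ == _); rewrite ?normr1 ?normr0.
have : pw (k + 3) <= pw k.+1 :> R by apply: pw_le; rewrite addn3 ltnS; exact: leqW (leqnSn k).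
by move: ex ke h; have := @pwS R k; lra.
Qed.

Context (core_le : forall j, 4 * a j <= D j).

Let aD j : a j <= D j.
Proof. by have := core_le j; have := core_sq_gt0 j; lra. Qed.

Lemma bump_fun_out j x : D j <= sqdist (bump_center j) x -> bump_fun j x = 0.
Proof. by move=> Dx; apply: radial_bump_out => //; exact: core_sq_gt0. Qed.

Lemma bump_fun_locally_finite (x : 'rV[R]_n) : x != 0 ->
  exists M, \forall y \near x, forall k, (M <= k)%N -> bump_fun k y = 0.
Proof.
move=> x0; have [i xi] : exists i, x ord0 i != 0.
  apply/existsP; rewrite -[X in is_true X]negbK negb_exists; apply: contraNN x0.
  move=> /forallP h; apply/eqP/rowP => i; rewrite mxE.
  by apply/eqP; rewrite -[_ == _]negbK h.
have eta0 : 0 < `|x ord0 i| / 2 by rewrite divr_gt0// normr_gt0.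
have [M Mx] := pw_small eta0; exists M.
have : \forall y \near x, `|x ord0 i| / 2 < `|(y : 'rV[R]_n) ord0 i|.
  have c := @coord_continuous R 1 n ord0 i x.
  apply: (cvgr_norm_gt _ c).
  by rewrite ltr_pdivrMr// mulr_natr mulr2n ltrDr normr_gt0.
apply: filterS => y yx k Mk; apply: bump_fun_out.
apply: support_away yx _; exact: le_trans (pw_le Mk) Mx.
Qed.

(** The supports accumulate at the origin, yet every term of the series vanishes there, so the
    partial sums converge at 0 too, as measurability on the whole space requires. *)
Lemma bump_fun0 k : bump_fun k 0 = 0.
Proof.
apply: bump_fun_out.
have -> : sqdist (bump_center k) 0 = sqdist 0 (bump_center k).
  by apply: eq_bigr => i _; rewrite -sqrrN opprB.
rewrite sqdist_center0 /support_sq lerXn2r ?nnegrE ?(ltW (pw_gt0 _))//.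
by apply: pw_le; rewrite addn3 ltnS; exact: leqW (leqnSn k).
Qed.

(** * Pointwise bounds on the solution *)

Lemma solution_active j x : sqdist (bump_center j) x < D j ->
  solution x = back_fun x + bump_fun j x.
Proof.
move=> jx; rewrite /solution /add_bumps; congr (_ + _).
apply: (@limn_sum_single _ (fun k => bump_fun k x)) => k kj; apply: bump_fun_out; rewrite leNgt.
by apply: contra kj => kx; apply/eqP; exact: supports_disjoint kx jx.
Qed.

Lemma solution_inactive x : (forall j, D j <= sqdist (bump_center j) x) ->
  solution x = back_fun x.
Proof.
move=> jx; rewrite /solution /add_bumps -[RHS]addr0; congr (_ + _).
by rewrite (@limn_sumE _ (fun k => bump_fun k x) 0) ?big_ord0// => k _; exact: bump_fun_out.
Qed.

Lemma active_dec x : (exists j, sqdist (bump_center j) x < D j) \/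
  forall j, D j <= sqdist (bump_center j) x.
Proof.
have [h|h] := pselect (exists j, sqdist (bump_center j) x < D j); first by left.
by right => j; rewrite leNgt; apply/negP => jx; apply: h; exists j.
Qed.

Lemma active_sqdist0 j x : sqdist (bump_center j) x < D j -> sqdist 0 x <= 10.
Proof.
move=> jx; have := sqdist_le_double 0 (bump_center j) x; rewrite sqdist_center0.
have : pw j.+1 ^+ 2 <= 1 :> R by rewrite exprn_ile1 ?pw_le1 ?(ltW (pw_gt0 _)).
have : D j <= 1 by rewrite exprn_ile1 ?pw_le1 ?(ltW (pw_gt0 _)).
lra.
Qed.

Context (rho20 : 20 <= rho).
Context (tail_small : forall j,
  kappa * (tail_height m (a j) (D j) (H j) / D j) <= 96 / rho).
Context (tail_le1 : forall j,
  tail_height m (a j) (D j) (H j) * profile_sup m <= 1).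

(** The background, at least 2 near the bumps, outweighs the subtracted tail, at most 1. *)
Lemma solution_active_ge j x : sqdist (bump_center j) x < D j ->
  1 + H j * profile m ((a j)^-1 * sqdist (bump_center j) x) <= solution x.
Proof.
move=> jx; rewrite (solution_active jx).
have := background_ge2 rho20 (active_sqdist0 jx).
have := radial_bump_ge (D := D j) half_dim_gt0 (ltW (height_gt0 j)) (core_sq_gt0 j)
  (support_sq_gt0 j) (sqdist_ge0 (bump_center j) x).
have := tail_le1 j; rewrite /bump_fun /back_fun /=; lra.
Qed.

Lemma solution_active_ge1 j x : sqdist (bump_center j) x < D j -> 1 <= solution x.
Proof.
move=> jx; apply: le_trans (solution_active_ge jx); rewrite lerDl.
rewrite mulr_ge0 ?(ltW (height_gt0 _))// ltW// profile_gt0 ?half_dim_gt0//.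
by rewrite mulr_ge0 ?sqdist_ge0// invr_ge0 ltW// core_sq_gt0.
Qed.

Lemma solution_ge1 x : sqdist 0 x <= 10 -> 1 <= solution x.
Proof.
move=> x10; have [[j jx]|jx] := active_dec x; first exact: solution_active_ge1 jx.
rewrite solution_inactive//; have := background_ge2 rho20 x10.
by rewrite /back_fun /=; lra.
Qed.

Lemma solution_ge0 x : 0 <= solution x.
Proof.
have [[j /solution_active_ge1 jx]|jx] := active_dec x; first by lra.
by rewrite solution_inactive//; exact: background_ge0.
Qed.

Lemma solution_active_le j x : sqdist (bump_center j) x < D j ->
  solution x <= 16 + H j * profile m ((a j)^-1 * sqdist (bump_center j) x).
Proof.
move=> jx; rewrite (solution_active jx) lerD//.
  by apply: background_le; [have := rho20; lra|exact: sqdist_ge0].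
apply: radial_bump_le; rewrite ?half_dim_gt0 ?core_sq_gt0 ?support_sq_gt0 ?sqdist_ge0//.
exact/ltW/height_gt0.
Qed.

(** * Regularity and Laplacian of the solution *)

Lemma C2_back_fun : C2_on setT back_fun.
Proof. exact: (C2_on_radial 0 (has_C2_background rho)). Qed.

Lemma C2_bump_fun j : C2_on setT (bump_fun j).
Proof. exact: (C2_on_radial (bump_center j) (has_C2_radial_bump m (a j) (D j) (H j))). Qed.

Lemma C2_solution : C2_on [set x | x != 0] solution.
Proof.
apply: C2_on_add_bumps; [exact: C2_back_fun|exact: C2_bump_fun|].
exact: bump_fun_locally_finite.
Qed.

Lemma laplacian_back_fun x : sqdist 0 x <= 4 ->
  96 / rho <= - laplacian back_fun x <= n%:R * (96 / rho).
Proof.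
move=> x4; rewrite /back_fun (laplacian_radial 0 (has_C2_background rho)).
by apply: background_radial => //; [exact: dim_ge3|exact: sqdist_ge0].
Qed.

Lemma laplacian_bump_fun j x : - laplacian (bump_fun j) x =
  kappa * (H j / a j * Num.max 0 (1 - (a j)^-1 * sqdist (bump_center j) x) -
    tail_height m (a j) (D j) (H j) / D j *
      Num.max 0 (1 - (D j)^-1 * sqdist (bump_center j) x)).
Proof.
rewrite /bump_fun (laplacian_radial _ (has_C2_radial_bump m (a j) (D j) (H j))).
rewrite (radial_bump_laplacian _ dimE) ?core_sq_gt0 ?support_sq_gt0 ?sqdist_ge0//.
by rewrite opprK.
Qed.

Lemma laplacian_bump_fun_out j x : D j <= sqdist (bump_center j) x ->
  laplacian (bump_fun j) x = 0.
Proof.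
move=> Dx; apply: oppr_inj; rewrite laplacian_bump_fun oppr0.
have out (c : R) : 0 < c -> c <= sqdist (bump_center j) x ->
    Num.max 0 (1 - c^-1 * sqdist (bump_center j) x) = 0.
  by move=> c0 cx; rewrite max_l// subr_le0 mulrC ler_pdivlMr// mul1r.
rewrite !out ?core_sq_gt0 ?support_sq_gt0//; last exact: le_trans Dx.
by rewrite !mulr0 subrr mulr0.
Qed.

Lemma laplacian_solution_active j (x : 'rV[R]_n) : x != 0 -> sqdist (bump_center j) x < D j ->
  laplacian solution x = laplacian back_fun x + laplacian (bump_fun j) x.
Proof.
move=> x0 jx; have lf := bump_fun_locally_finite x0.
rewrite /solution (laplacian_add_bumps C2_back_fun C2_bump_fun lf); congr (_ + _).
apply: (@limn_sum_single _ (fun k => laplacian (bump_fun k) x)) => k kj.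
apply: laplacian_bump_fun_out; rewrite leNgt.
by apply: contra kj => kx; apply/eqP; exact: supports_disjoint kx jx.
Qed.

Lemma laplacian_solution_inactive (x : 'rV[R]_n) : x != 0 ->
  (forall j, D j <= sqdist (bump_center j) x) ->
  laplacian solution x = laplacian back_fun x.
Proof.
move=> x0 jx; have lf := bump_fun_locally_finite x0.
rewrite /solution (laplacian_add_bumps C2_back_fun C2_bump_fun lf).
rewrite (@limn_sumE _ (fun k => laplacian (bump_fun k) x) 0) ?big_ord0 ?addr0// => k _.
exact: laplacian_bump_fun_out.
Qed.

(** * Measurability and membership in L^lambda *)

Lemma measurable_solution :
  measurable_fun setT (fun t => solution (@rV_of_tuple R n t) : measurableTypeR R).
Proof.
have cG (G G1 G2 : R -> R) : has_C2 G G1 G2 -> continuous G.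
  by move=> [/is_derive_continuous].
apply: (measurable_fun_cvg (h := fun N t => partial_bumps back_fun bump_fun N
    (@rV_of_tuple R n t))).
- elim=> [|k IH] /=.
    exact: measurable_radial (cG _ _ _ (has_C2_background rho)).
  apply: measurable_funD; first exact: IH.
  exact: measurable_radial (cG _ _ _ (has_C2_radial_bump m (a k) (D k) (H k))).
- move=> t _; set y := rV_of_tuple t.
  have [M Mb] : exists M, forall k, (M <= k)%N -> bump_fun k y = 0.
    have [->|y0] := eqVneq y 0; first by exists 0%N => k _; exact: bump_fun0.
    have [M /nbhs_singleton My] := bump_fun_locally_finite y0.
    by exists M.
  under eq_fun do rewrite partial_bumpsE.
  rewrite /solution /add_bumps (limn_sumE Mb).
  by apply: cvgD; [exact: cvg_cst|exact: limn_sum_eventually Mb].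
Qed.

Lemma core_index_ge j : (j + 3 <= l j)%N.
Proof.
rewrite leqNgt; apply/negP => lj; have := core_le j; have := core_sq_gt0 j.
have : D j <= a j.
  rewrite /core_sq /support_sq lerXn2r ?nnegrE ?(ltW (pw_gt0 _))//.
  exact: pw_le (ltnW lj).
lra.
Qed.

(** The bound involves the shell only, neither [j] nor [l j]. Between core and support it is
    [profile_shell_bound] at the inner radius 2^-(k+1); in the core k = l j, and the height is
    already 2^(k S). *)
Lemma solution_shell_le j x : 0 < S -> S <= 2 * m ->
  sqdist (bump_center j) x < D j ->
  exists k, [/\ (j < k)%N, sqdist (bump_center j) x < pw k ^+ 2 &
    solution x <= (16 + profile_sup m) * pw k.+1 `^ (- S)].
Proof.
move=> S0 Sm jx; have m0 := half_dim_gt0.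
have [k [jk kl qk kE]] := dyadic_shell (core_index_ge j) jx.
exists k; split => //; first by apply: leq_trans jk; rewrite addn3 ltnS leqW.
apply: (le_trans (solution_active_le jx)); set q := sqdist _ _ in qk kE *.
have w1 : 1 <= pw k.+1 `^ (- S) :> R.
  rewrite powRN invf_ge1 ?powR_gt0 ?pw_gt0// -[leRHS](powRr0 (pw k.+1)).
  by apply: ger_powR; rewrite ?pw_gt0 ?pw_le1 ?(ltW S0).
rewrite mulrDl lerD//; first by rewrite ler_peMr.
case: kE => [kE|[kl' qk']]; last first.
  by apply: profile_shell_bound => //; [exact: core_radius_gt0|exact: pw_le].
rewrite mulrC; apply: ler_pM.
- by rewrite ltW// profile_gt0// mulr_ge0 ?sqdist_ge0// invr_ge0 ltW// core_sq_gt0.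
- exact/ltW/height_gt0.
- by apply: profile_le_sup => //; rewrite mulr_ge0 ?sqdist_ge0// invr_ge0 ltW// core_sq_gt0.
- rewrite /height /core_radius -kE !powRN lef_pV2 ?posrE ?powR_gt0 ?pw_gt0//.
  by apply: ge0_ler_powR; rewrite ?nnegrE ?(ltW (pw_gt0 _)) ?(ltW S0)//; exact: pw_le.
Qed.

(* Index 0 covers the background, index k > 0 the points of the bumps at
   distance about 2^-k from their centers: since d_j = 2^-(j + 3), only bumps
   with j < k have such points. *)
Definition shell_cover (k : nat) : set (n.-tuple (measurableTypeR R)) :=
  if k is 0 then box (fun=> - rho) (2 * rho)
  else \big[setU/set0]_(j < k) box (fun i => bump_center j ord0 i - pw k) (2 * pw k).

Lemma measurable_shell_cover k : measurable (shell_cover k).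
Proof.
case: k => [|k]; first exact: measurable_box.
by apply: bigsetU_measurable => j _; exact: measurable_box.
Qed.

Lemma measure_shell_cover_le k :
  (lebesgue_tuple R n (shell_cover k) <=
   (if k is 0 then (2 * rho) ^+ n else k%:R * (2 * pw k) ^+ n)%:E)%E.
Proof.
have rho0 : 0 < 2 * rho by have := rho20; lra.
case: k => [|k]; first by rewrite /shell_cover measure_box.
apply: (le_trans (@Boole_inequality _ _ _ (lebesgue_tuple R n)
  (fun j => box (fun i => bump_center j ord0 i - pw k.+1) (2 * pw k.+1)) k.+1 _)).
  by move=> j _; exact: measurable_box.
rewrite (eq_bigr (fun=> ((2 * pw k.+1) ^+ n)%:E)); last first.
  by move=> j _; apply: measure_box; rewrite mulr_gt0 ?pw_gt0.
by rewrite sumEFin sumr_const card_ord -[_ *+ k.+1]mulr_natl.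
Qed.

Lemma in_box_sqdist (p : 'rV[R]_n) (r : R) t : 0 <= r ->
  sqdist p (rV_of_tuple t) < r ^+ 2 ->
  box (fun i => p ord0 i - r) (2 * r) t.
Proof.
move=> r0 pr i; have := coord_lt_sqdist i r0 pr; rewrite mxE.
rewrite ltr_norml => /andP[h1 h2]; rewrite /= in_itv /=.
by apply/andP; split; lra.
Qed.

(** Shell k consists of k boxes of side 2 * 2^-k, on which u^lambda is at most a constant times 2^(k
    S lambda). It thus contributes a constant times k q^k with q = 2^-(n - S lambda), and q < 1
    because S lambda < n. *)
Lemma in_Lp_solution (lambda : R) : 0 < lambda -> 0 < S -> S <= 2 * m ->
  S * lambda < n%:R -> in_Lp lambda solution.
Proof.
move=> la0 S0 Sm Sla; split; first exact: measurable_solution.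
have mu := measurable_solution.
pose C := (16 + profile_sup m) `^ lambda.
pose q : R := 2^-1 `^ (n%:R - S * lambda).
pose c k := if k is 0 then 16 `^ lambda else C * pw k.+1 `^ (- (S * lambda)).
pose C1 := 16 `^ lambda * (2 * rho) ^+ n.
pose C2 := C * 2 `^ (S * lambda) * 2 ^+ n.
have q01 : 0 <= q < 1 by rewrite powR_ge0 powR_half_lt1// subr_gt0.
have sup0 : 0 <= profile_sup m.
  have := profile_coef_ge0 half_dim_gt0; have := half_dim_gt0.
  by rewrite /profile_sup; lra.
have c0 k : 0 <= c k by case: k => [|k]; rewrite ?mulr_ge0 ?powR_ge0.
apply: (@integral_lty_cover _ _ _ _ _ c shell_cover (C1 + C2 * (q / (1 - q) ^+ 2))).
- apply: (measurableT_comp (measurable_powR _)).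
  exact: (measurableT_comp (@normr_measurable _ _) mu).
- by move=> t; exact: powR_ge0.
- exact: c0.
- exact: measurable_shell_cover.
- move=> t; rewrite (ger0_norm (solution_ge0 _)); set y := rV_of_tuple t.
  have [[j jy]|jy] := active_dec y.
    move=> _; have [k [jk kq uk]] := solution_shell_le S0 Sm jy; exists k.
    case: k jk kq uk => // k jk kq uk; split.
      rewrite /shell_cover -(bigcup_mkord _ (fun j =>
        box (fun i => bump_center j ord0 i - pw k.+1) (2 * pw k.+1))).
      exists j => //; apply: in_box_sqdist kq; exact/ltW/pw_gt0.
    rewrite /c -mulNr (powRrM (pw k.+2)) -powRM ?powR_ge0//; last by lra.
    apply: ge0_ler_powR; rewrite ?nnegrE ?solution_ge0 ?(ltW la0)//.
    by rewrite mulr_ge0 ?powR_ge0//; lra.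
  rewrite solution_inactive// => uy; exists 0%N.
  have r1 : 1 <= rho by have := rho20; lra.
  have r0 : 0 < rho by lra.
  (* The support |y|^2 < rho lies in the ball of radius rho because rho >= 1; the oversized box
     saves a square root. *)
  have yr : sqdist 0 y < rho ^+ 2.
    have : sqdist 0 y < rho.
      rewrite ltNge; apply/negP => ry; move: uy.
      by rewrite /back_fun /= background_out// powR0 ?ltxx// gt_eqF.
    by move=> h; apply: (lt_le_trans h); rewrite expr2 ler_peMr// ltW.
  split.
    have := in_box_sqdist (ltW r0) yr; rewrite /shell_cover.
    by congr (box _ _ _); apply/funext => i; rewrite mxE sub0r.
  apply: ge0_ler_powR; rewrite ?nnegrE ?(ltW la0)//; first exact: background_ge0.
  by apply: background_le => //; exact: sqdist_ge0.
move=> M; apply: (@le_trans _ _ (\sum_(0 <= k < M)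
    ((if k is 0 then C1 else 0) + C2 * (k%:R * q ^+ k))%:E)%E).
  apply: lee_sum => k _.
  apply: (le_trans (lee_wpmul2l _ (measure_shell_cover_le k))).
    by rewrite lee_fin.
  case: k => [|k]; first by rewrite -EFinM lee_fin mul0r mulr0 addr0.
  rewrite -EFinM lee_fin add0r /c /C2 le_eqVlt; apply/orP; left; apply/eqP.
  have p0 := @pw_gt0 R k.+1.
  have -> : q ^+ k.+1 = pw k.+1 ^+ n * pw k.+1 `^ (- (S * lambda)).
    rewrite /q -powR_pow2E -[pw k.+1 ^+ n]powR_mulrn ?(ltW p0)//.
    by rewrite -powRD// ?(gt_eqF p0) ?implybT.
  have -> : pw k.+2 `^ (- (S * lambda)) =
      pw k.+1 `^ (- (S * lambda)) * 2 `^ (S * lambda).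
    rewrite pwS powRM ?(ltW p0) ?invr_ge0//; congr (_ * _).
    have h2 : 0 <= 2 :> R by [].
    by rewrite -[2^-1](powR_inv1 h2) -powRrM mulN1r opprK.
  by rewrite exprMn; ring.
rewrite sumEFin lee_fin big_split /= -mulr_sumr lerD//; last first.
  by rewrite ler_wpM2l ?sum_mul_geometric_le// /C2 !mulr_ge0 ?powR_ge0 ?exprn_ge0.
have C10 : 0 <= C1.
  by rewrite /C1 mulr_ge0 ?powR_ge0// exprn_ge0//; have := rho20; lra.
case: M => [|M]; first by rewrite big_nil.
by rewrite big_nat_recl//= big1 ?addr0.
Qed.

(** * The differential inequality *)

Lemma enorm_lt2 (x : 'rV[R]_n) : enorm x < 2 -> sqdist 0 x <= 4.
Proof.
have -> : enorm x = Num.sqrt (sqdist 0 x).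
  by congr (Num.sqrt _); apply: eq_bigr => i _; rewrite mxE subr0.
move=> x2; rewrite -[leLHS]sqr_sqrtr ?sqdist_ge0//.
have := sqrtr_ge0 (sqdist 0 x); rewrite expr2; nra.
Qed.

Lemma back_rate_ge0 : 0 <= 96 / rho.
Proof. by apply: divr_ge0 (ler0n _ 96) _; have := rho20; lra. Qed.

(** [tail_small] calibrates the tail against the rate 96 / rho of the background, which gives the
    sign; for the upper bound the tail has the favourable sign and is dropped. *)
Lemma laplacian_active_bounds j (x : 'rV[R]_n) : x != 0 -> sqdist 0 x <= 4 ->
  sqdist (bump_center j) x < D j ->
  0 <= - laplacian solution x /\
  - laplacian solution x <= n%:R * (96 / rho) +
    kappa * (H j / a j * Num.max 0 (1 - (a j)^-1 * sqdist (bump_center j) x)).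
Proof.
move=> x0 x4 jx; rewrite (laplacian_solution_active x0 jx).
have := laplacian_bump_fun j x; move: (laplacian (bump_fun j) x) => B BE.
have := laplacian_back_fun x4.
move: (laplacian back_fun x) => A /andP[lb ub].
rewrite opprD BE mulrBr.
have a0 := core_sq_gt0 j; have D0 := support_sq_gt0 j; have H0 := height_gt0 j.
have k0 := laplacian_coef_gt0; have thD := tail_small j.
have th0 : 0 <= tail_height m (a j) (D j) (H j) / D j.
  exact: divr_ge0 (tail_height_ge0 _ _ _ (ltW H0)) (ltW D0).
have q0 := sqdist_ge0 (bump_center j) x.
move: (sqdist (bump_center j) x) q0 => q q0.
have maxle (c : R) : 0 < c -> 0 <= Num.max 0 (1 - c^-1 * q) <= 1.
  move=> c0; rewrite le_max lexx /= ge_max ler01 gerBl.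
  by rewrite mulr_ge0// invr_ge0 ltW.
have /andP[xa0 _] := maxle _ a0; have /andP[xD0 xD1] := maxle _ D0.
have Ha0 : 0 <= H j / a j := divr_ge0 (ltW H0) (ltW a0).
move: (Num.max 0 _) xa0 => X X0; move: (Num.max 0 _) xD0 xD1 => Y Y0 Y1.
move: (tail_height _ _ _ _ / _) th0 thD => T T0 TD.
have kX0 := mulr_ge0 (ltW k0) (mulr_ge0 Ha0 X0).
have kT0 := mulr_ge0 (ltW k0) (mulr_ge0 T0 Y0).
have kT : kappa * (T * Y) <= kappa * T by rewrite ler_pM2l//; exact: ler_piMr.
by split; lra.
Qed.

Lemma solution_inequality (alpha lambda sigma : R) (x : 'rV[R]_n) :
  0 < alpha -> 0 <= lambda -> 0 <= sigma -> 0 <= S ->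
  n%:R * (96 / rho) <= (n%:R ^+ n)^-1 ->
  (forall j,
     (n%:R * (96 / rho) + kappa) * (H j / a j) <=
       (n%:R ^+ n)^-1 * H j `^ sigma \/
     (n%:R * (96 / rho) + kappa) * (H j / a j) <=
       (4 `^ (- m) * H j) `^ lambda * core_radius j `^ (- alpha) *
       (core_radius j / n%:R) ^+ n * H j `^ sigma) ->
  x != 0 -> enorm x < 2 ->
  0 <= - laplacian solution x /\
  ((- laplacian solution x)%:E <=
     riesz_conv alpha lambda solution x * (solution x `^ sigma)%:E)%E.
Proof.
move=> al0 la0 sg0 S0 back_small core x0 /enorm_lt2 x4.
have n0 : (0 < n)%N by exact: leq_trans n3.
have mu := measurable_solution; have m0 := half_dim_gt0.
have u1 : 1 <= solution x by apply: solution_ge1; lra.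
have us1 : 1 <= solution x `^ sigma.
  have : 1 `^ sigma <= solution x `^ sigma.
    by apply: ge0_ler_powR; rewrite ?nnegrE ?solution_ge0.
  by rewrite powR1.
have finish (c : R) : (c%:E <= riesz_conv alpha lambda solution x)%E ->
    - laplacian solution x <= c * solution x `^ sigma ->
    ((- laplacian solution x)%:E <=
     riesz_conv alpha lambda solution x * (solution x `^ sigma)%:E)%E.
  move=> cR h; apply: (@le_trans _ _ (c * solution x `^ sigma)%:E).
    by rewrite lee_fin.
  by rewrite EFinM; apply: lee_wpmul2r => //; rewrite lee_fin powR_ge0.
(* The unit ball around a point of B_2 lies in |y|^2 <= 10, where u >= 1; the cube of side 1/n then
   contributes n^-n. *)
have conv1 : (((n%:R ^+ n)^-1)%:E <= riesz_conv alpha lambda solution x)%E.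
  have := @riesz_conv_ge R n alpha lambda solution x 1 1 n0 al0 la0 ltr01 ler01 mu.
  rewrite !powR1 !mul1r exprVn; apply => y; rewrite expr1n => xy.
  apply: solution_ge1; have := sqdist_le_double 0 x y; lra.
have /andP[lb ub] := laplacian_back_fun x4.
have inv0 : 0 < (n%:R ^+ n)^-1 :> R by rewrite invr_gt0 exprn_gt0// ltr0n.
have easy : - laplacian solution x <= n%:R * (96 / rho) ->
    - laplacian solution x <= (n%:R ^+ n)^-1 * solution x `^ sigma.
  move=> h; apply: (le_trans h); apply: (le_trans back_small).
  by rewrite ler_peMr// ltW.
have d0 := back_rate_ge0.
have [[j jx]|jx] := active_dec x; last first.
  rewrite (laplacian_solution_inactive x0 jx) in finish easy *.
  by split; [lra|apply: finish conv1 (easy ub)].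
have [lap0] := laplacian_active_bounds x0 x4 jx.
have q0 := sqdist_ge0 (bump_center j) x.
have a0 := core_sq_gt0 j; have H0 := height_gt0 j; have k0 := laplacian_coef_gt0.
set q := sqdist (bump_center j) x in jx q0 *.
move: (laplacian solution x) finish easy lap0 => L finish easy lap0 lap1.
split => //.
have Ha0 : 0 <= H j / a j := divr_ge0 (ltW H0) (ltW a0).
(* Outside the core the positive part vanishes, and the background rate alone bounds -Delta u. *)
have [aq|qa] := leP (a j) q.
  apply: finish conv1 (easy _); move: lap1.
  rewrite max_l ?mulr0 ?addr0//.
  by rewrite subr_le0 mulrC ler_pdivlMr// mul1r.
have uH : H j <= solution x.
  apply: le_trans (solution_active_ge jx).
  have : 1 <= profile m ((a j)^-1 * q).
    by apply: profile_le1_ge1 => //; rewrite mulrC ler_pdivrMr// mul1r ltW.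
  by move=> h; have := ler_wpM2l (ltW H0) h; rewrite mulr1 -/q; lra.
have Hs : H j `^ sigma <= solution x `^ sigma.
  by apply: ge0_ler_powR; rewrite ?nnegrE ?(ltW H0)// solution_ge0.
(* Since H / a >= 1, the background rate fits into the same multiple of H / a. *)
have lapH : - L <= (n%:R * (96 / rho) + kappa) * (H j / a j).
  have Ha1 : 1 <= H j / a j.
    rewrite ler_pdivlMr// mul1r (le_trans _ (height_ge1 j S0))//.
    by rewrite exprn_ile1 ?pw_le1// ltW// pw_gt0.
  apply: (le_trans lap1); rewrite [leRHS]mulrDl; apply: lerD.
    by rewrite ler_peMr// mulr_ge0.
  rewrite ler_pM2l// ler_piMr// ge_max ler01 gerBl.
  by rewrite mulr_ge0// invr_ge0 ltW.
case: (core j) => cj.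
  apply: finish conv1 _; apply: (le_trans lapH); apply: (le_trans cj).
  by rewrite ler_wpM2l// ltW.
have cH0 : 0 <= 4 `^ (- m) * H j by rewrite mulr_ge0 ?powR_ge0// ltW.
(* Second alternative: the core itself feeds the convolution, through the ball of core radius around
   [x]. That ball stays at squared distance below 4 a <= D from the centre, and there u >= 4^-m
   H. *)
have convH := @riesz_conv_ge R n alpha lambda solution x (core_radius j)
  (4 `^ (- m) * H j) n0 al0 la0 (core_radius_gt0 j) cH0 mu.
apply: finish (convH _) _.
  move=> y xy; rewrite -/(a j) in xy.
  have qy4 : sqdist (bump_center j) y < 4 * a j.
    by have := sqdist_le_double (bump_center j) x y; rewrite -/q; lra.
  have jy : sqdist (bump_center j) y < D j by exact: lt_le_trans qy4 (core_le j).
  apply: le_trans (solution_active_ge jy); rewrite mulrC.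
  have z0 : 0 <= (a j)^-1 * sqdist (bump_center j) y.
    by rewrite mulr_ge0 ?sqdist_ge0// invr_ge0 ltW.
  have z4 : (a j)^-1 * sqdist (bump_center j) y <= 4.
    by rewrite mulrC ler_pdivrMr// ltW.
  have := ler_wpM2l (ltW H0) (profile_ge_powR4 m0 z0 z4); lra.
apply: (le_trans lapH); apply: (le_trans cj); apply: ler_wpM2l => //.
by rewrite !mulr_ge0 ?powR_ge0// exprn_ge0// divr_ge0// ltW// core_radius_gt0.
Qed.

(** * Growth along the centres *)

Lemma solution_center_ge j : H j <= solution (bump_center j).
Proof.
have q0 : sqdist (bump_center j) (bump_center j) = 0.
  by apply: big1 => i _; rewrite subrr expr0n.
have jx : sqdist (bump_center j) (bump_center j) < D j.
  by rewrite q0 support_sq_gt0.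
apply: le_trans (solution_active_ge jx); rewrite q0 mulr0.
have := ler_wpM2l (ltW (height_gt0 j))
  (profile_le1_ge1 half_dim_gt0 (ler01 : (0 : R) <= 1)).
rewrite mulr1; lra.
Qed.

Lemma enorm_center j : enorm (bump_center j) = pw j.+1.
Proof.
have -> : enorm (bump_center j) = Num.sqrt (sqdist 0 (bump_center j)).
  by congr (Num.sqrt _); apply: eq_bigr => i _; rewrite [X in _ - X]mxE subr0.
by rewrite sqdist_center0 sqrtr_sqr gtr0_norm// pw_gt0.
Qed.

Lemma center_cvg0 : bump_center @ \oo --> (0 : 'rV[R]_n).
Proof.
rewrite -[X in _ --> X](scale0r (delta_mx ord0 i0)).
apply: cvgZr_tmp; rewrite (cvg_shiftS (fun k => pw k : R)).
by apply: cvg_expr; rewrite gtr0_norm ?invr_gt0// invf_lt1 ?ltr1n.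
Qed.

Lemma center_neq0 j : bump_center j != 0.
Proof.
apply/negP => /eqP /rowP /(_ i0); rewrite center_coord mxE eqxx mulr1.
by apply/eqP; rewrite gt_eqF// pw_gt0.
Qed.

(** At the centre of bump j, a nonzero point of norm 2^-(j+1), u is at least j + 1 times phi, which
    defeats any constant K once j >= K. *)
Lemma solution_not_bigO (phi : R -> R) :
  (forall t, 0 < t < 1 -> 0 < phi t) ->
  (forall j, (j%:R + 1) * phi (pw j.+1) <= H j) ->
  ~ ((solution : 'rV[R]_n -> R^o) =O_ ((0 : 'rV[R]_n)^')
       (fun x => phi (enorm x) : R^o)).
Proof.
move=> phi0 phiH /eqO_exP[K K0 near0].
have : \forall j \near \oo, `|solution (bump_center j)| <=
    K * `|phi (enorm (bump_center j))|.
  have near0' : \forall x \near (0 : 'rV[R]_n), x != 0 ->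
      `|solution x| <= K * `|phi (enorm x)| := near0.
  have h : \forall j \near \oo, bump_center j != 0 -> `|solution (bump_center j)|
      <= K * `|phi (enorm (bump_center j))| := center_cvg0 near0'.
  by apply: filterS h => j; apply; exact: center_neq0.
have big : \forall j \near \oo, K <= j%:R :> R by exact: nbhs_infty_ger.
move=> small; near \oo => j.
have Kj : K <= j%:R by near: j.
have : `|solution (bump_center j)| <= K * `|phi (enorm (bump_center j))| by near: j.
rewrite enorm_center (ger0_norm (solution_ge0 _)).
have p0 : 0 < phi (pw j.+1).
  by apply: phi0; rewrite pw_gt0 pwS; have := @pw_le1 R j; lra.
rewrite gtr0_norm//; have := solution_center_ge j; have := phiH j.
have : K * phi (pw j.+1) <= j%:R * phi (pw j.+1) by rewrite ler_wpM2r// ltW.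
lra.
Unshelve. all: by end_near. Qed.

End Construction.

Unset Implicit Arguments.

Theorem theorem1p2 (R : realType) (n : nat) (hn : (3 <= n)%N)
    (alpha lambda sigma : R)
    (halpha0 : 0 < alpha) (halphan : alpha < n%:R) (hlambda : 0 < lambda)
    (hsigma : g_exp n alpha lambda < sigma)
    (phi : R -> R)
    (phi_pos : forall t : R, 0 < t < 1 -> 0 < phi t)
    (phi_cont : {within `]0, 1[, continuous phi})
    (phi_lim : phi t @[t --> 0^'+] --> +oo) :
  exists u : 'rV[R]_n -> R,
    [/\ forall x, x != 0 -> 0 <= u x,
        C2_on [set x | x != 0] u,
        in_Lp lambda u,
        forall x, x != 0 -> enorm x < 2 ->
          0 <= - laplacian u x /\
          ((- laplacian u x)%:E <=
             riesz_conv alpha lambda u x * (u x `^ sigma)%:E)%E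
      & ~ ((u : 'rV[R]_n -> R^o) =O_ ((0 : 'rV[R]_n)^')
             (fun x => phi (enorm x) : R^o))].
Proof.
have al : 0 < alpha < n%:R by rewrite halpha0.
have [sg0 [S [S0 Sn Sla core]]] := exponent_choice hn al hlambda hsigma.
have n0 : (0 < n)%N by exact: leq_trans hn.
have N0 : 0 < n%:R :> R by rewrite ltr0n.
have m0 := half_dim_gt0 R hn; have k0 := laplacian_coef_gt0 R hn.
have Sm : S < 2 * half_dim R n by rewrite /half_dim mulrCA divff ?mulr1.
pose nn : R := n%:R ^+ n.
have nn0 : 0 < nn by rewrite exprn_gt0.
(* The 20 is required by the bounds on the background; the other term forces n * 96 / rho <= n^-n,
   the guaranteed size of the convolution. *)
pose rho := 20 + 96 * n%:R * nn.
have c0 : 0 < 96 * n%:R * nn by rewrite !mulr_gt0.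
have rho20 : 20 <= rho by rewrite /rho lerDl ltW.
have rho0 : 0 < rho by apply: lt_le_trans rho20.
have back_small : n%:R * (96 / rho) <= nn^-1.
  rewrite mulrA ler_pdivrMr// ler_pdivlMl//.
  by rewrite (_ : nn * _ = 96 * n%:R * nn) ?lerDr//; ring.
have d0 : 0 < 96 / rho by rewrite divr_gt0.
(* For each j separately, the height is required to exceed (j + 1) phi at the norm of the j-th
   centre. *)
have /choice[l lP] := fun j => scale_choice
  ((j%:R + 1) * phi (pw j.+1)) n0 S0 Sm m0 k0 d0 (support_sq_gt0 R j) core.
have core_le j : 4 * core_sq R l j <= support_sq R j by have [] := lP j.
have tail_small j : laplacian_coef R n * (tail_height (half_dim R n)
    (core_sq R l j) (support_sq R j) (height S l j) / support_sq R j) <= 96 / rho.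
  by have [] := lP j.
have tail_le1 j : tail_height (half_dim R n) (core_sq R l j) (support_sq R j)
    (height S l j) * profile_sup (half_dim R n) <= 1 by have [] := lP j.
exists (solution S rho l hn); split.
- by move=> x _; exact: solution_ge0.
- exact: C2_solution.
- by apply: in_Lp_solution => //; exact: ltW.
- move=> x x0 x2; apply: solution_inequality => //; try exact: ltW.
  by move=> j; have [] := lP j.
- apply: solution_not_bigO => // j.
  by have [] := lP j.
Qed.
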